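(* Let $p\ne5$ be an odd prime and let $G_p(X,Y)=\sum_{0\le i,j\le p+1}C_{i,j}X^iY^j\in\mathbb{Q}[X,Y]$ be a nonzero polynomial with $G_p(g(\tau),g(p\tau))=0$ for all $\tau\in\mathbb{H}$ (the modular equation for $g$ of level $p$). Then (1) $C_{p+1,0}\ne0$ and $C_{0,p+1}\ne0$; (2) $C_{p+1,j}=C_{j,p+1}=0$ for all $j\in\{1,2,\dots,p+1\}$; (3) $C_{0,j}=C_{j,0}=0$ for all $j\in\{0,1,\dots,p\}$.
   Context: $q=e^{2\pi i\tau}$, $\eta(\tau)=q^{1/24}\prod_{n\ge1}(1-q^n)$, and $g(\tau)=\dfrac{\eta^2(2\tau)\eta^4(5\tau)}{\eta^4(\tau)\eta^2(10\tau)}$. *)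

(* Defs.v *)
From Stdlib Require Import Reals QArith ZArith Znumtheory.
From Coquelicot Require Import Coquelicot.
Open Scope R_scope.

Definition cexp (z : C) : C :=
  (exp (Re z) * cos (Im z), exp (Re z) * sin (Im z)).

Fixpoint cpow (z : C) (n : nat) : C :=
  match n with O => RtoC 1 | S m => Cmult z (cpow z m) end.

Definition qpar (tau : C) : C := cexp (Cmult (RtoC (2 * PI)) (Cmult Ci tau)).

Fixpoint eta_prod (tau : C) (N : nat) : C :=
  match N with
  | O => RtoC 1
  | S M => Cmult (eta_prod tau M) (Cminus (RtoC 1) (cpow (qpar tau) (S M)))
  end.

Definition eta_inf (tau : C) : C :=
  (real (Lim_seq (fun N => Re (eta_prod tau N))),
   real (Lim_seq (fun N => Im (eta_prod tau N)))).

Definition dedekind_eta (tau : C) : C :=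
  Cmult (cexp (Cmult (RtoC (2 * PI / 24)) (Cmult Ci tau))) (eta_inf tau).

Definition gfun (tau : C) : C :=
  Cdiv (Cmult (cpow (dedekind_eta (Cmult (RtoC 2) tau)) 2)
              (cpow (dedekind_eta (Cmult (RtoC 5) tau)) 4))
       (Cmult (cpow (dedekind_eta tau) 4)
              (cpow (dedekind_eta (Cmult (RtoC 10) tau)) 2)).

Definition poly2_eval (d : nat) (Cf : nat -> nat -> Q) (x y : C) : C :=
  sum_n (fun i => sum_n (fun j =>
     Cmult (RtoC (Q2R (Cf i j))) (Cmult (cpow x i) (cpow y j))) d) d.

(* Main.v *)
Require Import Defs.
From Stdlib Require Import Reals QArith ZArith Znumtheory Lra Lia.
From Coquelicot Require Import Coquelicot.
Open Scope R_scope.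

(** No modular transformation is needed: only the exponential rate at which [g] grows or decays when
    [tau] tends vertically to a rational. If [w] is a primitive [k]-th root of unity, grouping the
    factors of [prod (1 - w^n r^n)] into blocks of length [k] and using
    [prod_{j<k} (1 - w^j X) = 1 - X^k] gives [log |prod (1 - w^n r^n)| = - L(r^(k^2)) + O(1)], with
    [L(r) = - log (prod (1 - r^n))], and a monotonicity argument gives [L(r^a) ~ L(r) / a] as
    [r -> 1]. Hence, near [h/k] in lowest terms, [log |g|] is asymptotic to a positive multiple of
    [L] when [k] is coprime to 10, and to a negative multiple when [k = 5 m] with [m] coprime to 10.
    Letting [tau] tend to 0, 1/p, 1/5 and 1/(5p), the pair [(log |g(tau)|, log |g(p tau)|)] grows
    like [(p, 1)], [(1, p)], [-(p, 1)] and [-(1, p)] times a common quantity tending to infinity. A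
    term of the polynomial whose weight strictly exceeds that of all other terms must vanish, and
    these four weights alone force the claimed shape of the coefficients. *)

(* [ring] needs the equality at type [C], not at a Coquelicot structure on it. *)
Ltac cring :=
  change (@plus _) with Cplus; simpl;
  match goal with |- ?a = ?b => change (@eq C a b) end; ring.

(** * Finite real sums and complex products *)

Fixpoint rsum (f : nat -> R) (n : nat) : R :=
  match n with O => 0 | S m => rsum f m + f m end.

Fixpoint cprod (f : nat -> C) (n : nat) : C :=
  match n with O => RtoC 1 | S m => Cmult (cprod f m) (f m) end.

Lemma rsum_ext (f g : nat -> R) (n : nat) :
  (forall i, (i < n)%nat -> f i = g i) -> rsum f n = rsum g n.
Proof.
  induction n as [|n IH]; intros H; simpl; trivial.
  rewrite IH, H; auto; intros; apply H; lia.
Qed.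

Lemma rsum_add (f : nat -> R) (n m : nat) :
  rsum f (n + m) = rsum f n + rsum (fun i => f (n + i)%nat) m.
Proof.
  induction m as [|m IH]; simpl.
  - rewrite Nat.add_0_r; ring.
  - rewrite Nat.add_succ_r; simpl; rewrite IH; ring.
Qed.

Lemma rsum_close (f g : nat -> R) (n : nat) (e : R) :
  (forall i, (i < n)%nat -> Rabs (f i - g i) <= e) ->
  Rabs (rsum f n - rsum g n) <= INR n * e.
Proof.
  induction n as [|n IH]; intros H; simpl rsum.
  - simpl; rewrite Rminus_0_r, Rabs_R0; lra.
  - rewrite S_INR.
    replace (rsum f n + f n - (rsum g n + g n))
      with ((rsum f n - rsum g n) + (f n - g n)) by ring.
    eapply Rle_trans; [apply Rabs_triang|].
    assert (Rabs (f n - g n) <= e) by (apply H; lia).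
    assert (Rabs (rsum f n - rsum g n) <= INR n * e) by (apply IH; intros; apply H; lia).
    lra.
Qed.

Lemma ln_Cmod_cprod (f : nat -> C) (n : nat) :
  (forall i, (i < n)%nat -> 0 < Cmod (f i)) ->
  0 < Cmod (cprod f n) /\ ln (Cmod (cprod f n)) = rsum (fun i => ln (Cmod (f i))) n.
Proof.
  induction n as [|n IH]; intros H; simpl.
  - rewrite Cmod_1, ln_1; split; [lra | trivial].
  - destruct IH as [H1 H2]; [intros; apply H; lia|].
    assert (H3 : 0 < Cmod (f n)) by (apply H; lia).
    rewrite Cmod_mult; split; [now apply Rmult_lt_0_compat|].
    rewrite ln_mult, H2; trivial.
Qed.

(** * The cyclotomic identity at a primitive root of unity *)

Definition primitive_root (k : nat) (w : C) : Prop :=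
  (0 < k)%nat /\ (w ^ k)%C = RtoC 1 /\
  forall j, (0 < j < k)%nat -> (w ^ j)%C <> RtoC 1.

(* Coefficient of [X^i] in the product of the [1 - w^j X] for [j < n]. *)
Fixpoint qcoef (w : C) (n i : nat) : C :=
  match n with
  | O => match i with O => RtoC 1 | S _ => RtoC 0 end
  | S m => Cminus (qcoef w m i)
             (Cmult (w ^ m)%C (match i with O => RtoC 0 | S i' => qcoef w m i' end))
  end.

Lemma qcoef_0 (w : C) (n : nat) : qcoef w n 0 = RtoC 1.
Proof. induction n as [|n IH]; simpl; trivial; rewrite IH; ring. Qed.

Lemma qcoef_large (w : C) (n i : nat) : (n < i)%nat -> qcoef w n i = RtoC 0.
Proof.
  revert i; induction n as [|n IH]; intros [|i] H; simpl; try lia; trivial.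
  rewrite !IH by lia; ring.
Qed.

(* Compares coefficients in [(1 - X) Q(w X) = (1 - w^n X) Q(X)]. *)
Lemma qcoef_rec (w : C) (n i : nat) :
  (qcoef w n (S i) * (RtoC 1 - w ^ (S i)) = (w ^ n - w ^ i) * qcoef w n i)%C.
Proof.
  revert i; induction n as [|n IH]; intros i.
  - destruct i; simpl; ring.
  - destruct i as [|i].
    + generalize (IH 0%nat); simpl; intros E.
      replace ((qcoef w n 1 - w ^ n * qcoef w n 0) * (RtoC 1 - w * RtoC 1))%C
        with (qcoef w n 1 * (RtoC 1 - w * RtoC 1)
              - w ^ n * qcoef w n 0 * (RtoC 1 - w))%C by ring.
      rewrite E; ring.
    + generalize (IH (S i)) (IH i); intros E1 E2.
      change (qcoef w (S n) (S (S i))) with (qcoef w n (S (S i)) - w ^ n * qcoef w n (S i))%C.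
      change (qcoef w (S n) (S i)) with (qcoef w n (S i) - w ^ n * qcoef w n i)%C.
      replace ((qcoef w n (S (S i)) - w ^ n * qcoef w n (S i)) * (RtoC 1 - w ^ (S (S i))))%C
        with (qcoef w n (S (S i)) * (RtoC 1 - w ^ (S (S i)))
              - w ^ n * qcoef w n (S i) * (RtoC 1 - w ^ (S (S i))))%C by ring.
      rewrite E1.
      replace ((w ^ (S n) - w ^ (S i)) * (qcoef w n (S i) - w ^ n * qcoef w n i))%C
        with ((w ^ (S n) - w ^ (S i)) * qcoef w n (S i)
              - w ^ n * w * ((w ^ n - w ^ i) * qcoef w n i))%C by (simpl; ring).
      rewrite <- E2; simpl; ring.
Qed.

(** At [w ^ k = 1] the recurrence says that [qcoef w k m * (1 - w ^ m)] does not depend on [m]. It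
    is 0 at [m = 0], and for [0 < i < k] the factor [1 - w ^ i] can be cancelled. *)
Lemma qcoef_root (w : C) (k i : nat) :
  primitive_root k w -> (0 < i < k)%nat -> qcoef w k i = RtoC 0.
Proof.
  intros (Hk & Hw & Hp) Hi.
  assert (D : forall m, (qcoef w k m * (RtoC 1 - w ^ m) = RtoC 0)%C).
  { induction m as [|m IH]; [simpl; ring|].
    rewrite qcoef_rec, Hw, <- IH; ring. }
  specialize (Hp i Hi); specialize (D i).
  destruct (Ceq_dec (qcoef w k i) (RtoC 0)) as [E|E]; trivial.
  exfalso; apply (Cmult_neq_0 _ _ E) in D; trivial.
  intros E'; apply Hp.
  replace (w ^ i)%C with (RtoC 1 - (RtoC 1 - w ^ i))%C by ring; rewrite E'; ring.
Qed.

(** This is multiplication by [1 - w ^ n * X] on truncated series. The factor [X] raises degrees by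
    one, so the second sum stops one index earlier. *)
Lemma sum_qcoef_step (w X : C) (n M : nat) :
  (sum_n (fun i => qcoef w (S n) i * X ^ i)%C (S M) =
   sum_n (fun i => qcoef w n i * X ^ i)%C (S M)
   - w ^ n * X * sum_n (fun i => qcoef w n i * X ^ i)%C M)%C.
Proof.
  induction M as [|M IH].
  - rewrite !sum_Sn, !sum_O; cring.
  - rewrite sum_Sn, IH, (sum_Sn _ (S M)), (sum_Sn _ M).
    change (qcoef w (S n) (S (S M))) with (qcoef w n (S (S M)) - w ^ n * qcoef w n (S M))%C.
    cring.
Qed.

Lemma cprod_qcoef (w X : C) (n : nat) :
  cprod (fun j => RtoC 1 - w ^ j * X)%C n = sum_n (fun i => qcoef w n i * X ^ i)%C n.
Proof.
  induction n as [|n IH].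
  - rewrite sum_O; cring.
  - rewrite sum_qcoef_step, sum_Sn, qcoef_large by lia; simpl cprod; rewrite IH.
    cring.
Qed.

(** Only the constant and the top coefficient survive, and evaluation at 1 determines the latter. *)
Lemma cprod_cyclotomic (w X : C) (k : nat) :
  primitive_root k w -> cprod (fun j => RtoC 1 - w ^ j * X)%C k = (RtoC 1 - X ^ k)%C.
Proof.
  intros Hw.
  assert (Hk : (0 < k)%nat) by apply Hw.
  assert (E : forall Y, cprod (fun j => RtoC 1 - w ^ j * Y)%C k
                        = (RtoC 1 + qcoef w k k * Y ^ k)%C).
  { intros Y; rewrite cprod_qcoef.
    assert (Z : forall m, (m < k)%nat -> sum_n (fun i => qcoef w k i * Y ^ i)%C m = RtoC 1).
    { induction m as [|m IH]; intros Hm.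
      - rewrite sum_O, qcoef_0; cring.
      - rewrite sum_Sn, IH, qcoef_root by (trivial; lia); cring. }
    destruct k as [|m]; [lia|].
    rewrite sum_Sn, Z by lia; trivial. }
  (* At 1 the factor [j = 0] is zero, so the product vanishes and the top coefficient must be -1. *)
  assert (Z : forall n, cprod (fun j => RtoC 1 - w ^ j * RtoC 1)%C (S n) = RtoC 0).
  { induction n as [|n IH]; [simpl; ring|].
    change (cprod (fun j => RtoC 1 - w ^ j * RtoC 1)%C (S n)
            * (RtoC 1 - w ^ (S n) * RtoC 1) = RtoC 0)%C.
    rewrite IH; ring. }
  generalize (E (RtoC 1)); destruct k as [|m]; [lia|].
  rewrite Z, Cpow_1_l; intros E1.
  rewrite E.
  replace (qcoef w (S m) (S m)) with (RtoC 1 + qcoef w (S m) (S m) * RtoC 1 - RtoC 1)%C by ring.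
  rewrite <- E1; ring.
Qed.

(** * Growth of eta products near roots of unity *)

Lemma Cmod_triangle_rev (a b : C) : Rabs (Cmod a - Cmod b) <= Cmod (a - b).
Proof.
  assert (H : forall x y : C, Cmod x - Cmod y <= Cmod (x - y)).
  { intros x y; generalize (Cmod_triangle (x - y) y).
    replace (x - y + y)%C with x by ring; lra. }
  apply Rabs_le; split; [|apply H].
  generalize (H b a); replace (b - a)%C with (- (a - b))%C by ring.
  rewrite Cmod_opp; lra.
Qed.

Lemma primitive_root_Cmod (k : nat) (w : C) : primitive_root k w -> Cmod w = 1.
Proof.
  intros (Hk & Hw & _).
  assert (E : Cmod w ^ k = 1) by (rewrite <- Cmod_pow, Hw; apply Cmod_1).
  apply pow_R1 in E; destruct E as [E|E]; [|lia].
  now rewrite Rabs_pos_eq in E by apply Cmod_ge_0.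
Qed.

(** Add [|1 - w| <= |1 - w x| + (1 - x)] and [1 <= |1 - w x| + x]; the terms in [x] cancel. *)
Lemma Cmod_unit_gap (w : C) (x : R) :
  Cmod w = 1 -> 0 <= x <= 1 -> Cmod (RtoC 1 - w) / 2 <= Cmod (RtoC 1 - w * RtoC x).
Proof.
  intros Hw Hx.
  assert (H1 : Cmod (RtoC 1 - w) <= Cmod (RtoC 1 - w * RtoC x) + (1 - x)).
  { replace (RtoC 1 - w)%C with ((RtoC 1 - w * RtoC x) + w * (RtoC (x - 1)))%C
      by (rewrite RtoC_minus; ring).
    eapply Rle_trans; [apply Cmod_triangle|].
    rewrite Cmod_mult, Hw, Cmod_R, Rabs_left1 by lra; lra. }
  assert (H2 : 1 <= Cmod (RtoC 1 - w * RtoC x) + x).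
  { rewrite <- Cmod_1 at 1.
    replace (RtoC 1) with ((RtoC 1 - w * RtoC x) + w * RtoC x)%C at 1 by ring.
    eapply Rle_trans; [apply Cmod_triangle|].
    rewrite Cmod_mult, Hw, Cmod_R, Rabs_pos_eq by lra; lra. }
  lra.
Qed.

(** The constant is a minimum over finitely many [j] of [|1 - w ^ j| / 2]. Its uniformity in [x]
    makes the logarithms of these factors Lipschitz as the radius tends to 1. *)
Lemma primitive_root_gap (k : nat) (w : C) :
  primitive_root k w ->
  exists c, 0 < c <= 1 /\
    forall j x, (0 < j < k)%nat -> 0 <= x <= 1 -> c <= Cmod (RtoC 1 - w ^ j * RtoC x).
Proof.
  intros Hw.
  assert (H : forall m, (m <= k)%nat -> exists c, 0 < c <= 1 /\
    forall j x, (0 < j < m)%nat -> 0 <= x <= 1 -> c <= Cmod (RtoC 1 - w ^ j * RtoC x)).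
  { induction m as [|m IH]; intros Hm.
    - exists 1; split; [lra | intros; lia].
    - destruct IH as (c & Hc & H); [lia|].
      destruct (Nat.eq_dec m 0) as [->|Hm0].
      + exists c; split; trivial; intros; lia.
      + assert (G : 0 < Cmod (RtoC 1 - w ^ m)).
        { apply Cmod_gt_0; intros E.
          apply (proj2 (proj2 Hw) m); [lia|].
          replace (w ^ m)%C with (RtoC 1 - (RtoC 1 - w ^ m))%C by ring; rewrite E; ring. }
        exists (Rmin c (Cmod (RtoC 1 - w ^ m) / 2)); split.
        * split; [apply Rmin_pos; lra|].
          eapply Rle_trans; [apply Rmin_l | lra].
        * intros j x Hj Hx; destruct (Nat.eq_dec j m) as [->|Hjm].
          -- eapply Rle_trans; [apply Rmin_r|].
             apply Cmod_unit_gap; trivial.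
             rewrite Cmod_pow, (primitive_root_Cmod k w Hw), pow1; trivial.
          -- eapply Rle_trans; [apply Rmin_l|]; apply H; trivial; lia. }
  apply (H k); lia.
Qed.

Lemma ln_le_sub_1 (x : R) : 0 < x -> ln x <= x - 1.
Proof.
  intros Hx; generalize (exp_ineq1_le (ln x)); rewrite exp_ln by trivial; lra.
Qed.

(** From [ln a - ln b = ln (a / b) <= a / b - 1 = (a - b) / b], used in both directions. *)
Lemma ln_lipschitz (c u v : R) :
  0 < c -> c <= u -> c <= v -> Rabs (ln u - ln v) <= Rabs (u - v) / c.
Proof.
  intros Hc.
  assert (H : forall a b, c <= a -> c <= b -> ln a - ln b <= Rabs (a - b) / c).
  { intros a b Ha Hb.
    rewrite <- ln_div by lra.
    eapply Rle_trans; [apply ln_le_sub_1; apply Rdiv_lt_0_compat; lra|].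
    replace (a / b - 1) with ((a - b) / b) by (field; lra).
    eapply Rle_trans;
      [apply Rmult_le_compat_r; [left; apply Rinv_0_lt_compat; lra | apply Rle_abs]|].
    apply Rmult_le_compat_l; [apply Rabs_pos|].
    apply Rinv_le_contravar; trivial. }
  intros Hu Hv; apply Rabs_le; split.
  - generalize (H v u Hv Hu); rewrite Rabs_minus_sym; lra.
  - auto.
Qed.

Lemma pow_in_01 (r : R) (n : nat) : 0 < r < 1 -> 0 < r ^ n <= 1.
Proof.
  intros Hr; split; [apply pow_lt; lra|].
  rewrite <- (pow1 n); apply pow_incr; lra.
Qed.

Lemma pow_S_in_01 (r : R) (n : nat) : 0 < r < 1 -> 0 < r ^ (S n) < 1.
Proof.
  intros Hr; generalize (pow_in_01 r n Hr); intros H; split.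
  - apply pow_lt; lra.
  - simpl; nra.
Qed.

Lemma pow_pos_in_01 (r : R) (n : nat) : (0 < n)%nat -> 0 < r < 1 -> 0 < r ^ n < 1.
Proof. destruct n; [lia|]; intros _; apply pow_S_in_01. Qed.

Definition elog_part (r : R) (N : nat) : R := rsum (fun n => - ln (1 - r ^ (S n))) N.

(** This is the function [L] of the introduction. [real] would turn an infinite limit into 0;
    [elog_is_lim] excludes this case for [0 < r < 1]. *)
Definition elog (r : R) : R := real (Lim_seq (elog_part r)).

Lemma opp_ln_bounds (x : R) : 0 < x < 1 -> 0 < - ln (1 - x) <= x / (1 - x).
Proof.
  intros Hx; split.
  - assert (ln (1 - x) < ln 1) by (apply ln_increasing; lra).
    rewrite ln_1 in *; lra.
  - rewrite <- ln_Rinv by lra.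
    eapply Rle_trans; [apply ln_le_sub_1; apply Rinv_0_lt_compat; lra|].
    right; field; lra.
Qed.

Lemma elog_part_incr (r : R) (N : nat) : 0 < r < 1 -> elog_part r N <= elog_part r (S N).
Proof.
  intros Hr; unfold elog_part; cbn [rsum].
  generalize (opp_ln_bounds _ (pow_S_in_01 r N Hr)); lra.
Qed.

Lemma elog_is_lim (r : R) : 0 < r < 1 -> is_lim_seq (elog_part r) (elog r).
Proof.
  intros Hr; apply Lim_seq_correct'.
  (* Each term is at most [r ^ n / (1 - r ^ n) <= r ^ n / (1 - r)], and the right-hand side is the
     partial geometric sum of these bounds. *)
  assert (B : forall N, elog_part r N <= r / (1 - r) / (1 - r) * (1 - r ^ N)).
  { induction N as [|N IH]; [unfold elog_part; simpl; lra|].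
    change (elog_part r N + - ln (1 - r ^ (S N)) <= r / (1 - r) / (1 - r) * (1 - r ^ S N)).
    generalize (opp_ln_bounds _ (pow_S_in_01 r N Hr)); intros H.
    assert (H2 : r ^ S N / (1 - r ^ S N) <= r ^ S N / (1 - r)).
    { apply Rmult_le_compat_l; [generalize (pow_S_in_01 r N Hr); lra|].
      apply Rinv_le_contravar; [lra|].
      generalize (pow_in_01 r N Hr); simpl; nra. }
    replace (r / (1 - r) / (1 - r) * (1 - r ^ S N)) with
      (r / (1 - r) / (1 - r) * (1 - r ^ N) + r ^ S N / (1 - r)) by (simpl; field; lra).
    lra. }
  apply ex_finite_lim_seq_incr with (r / (1 - r) / (1 - r)).
  - intros n; now apply elog_part_incr.
  - intros n; eapply Rle_trans; [apply B|].
    assert (0 < r / (1 - r) / (1 - r))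
      by (apply Rdiv_lt_0_compat; [apply Rdiv_lt_0_compat|]; lra).
    generalize (pow_in_01 r n Hr); nra.
Qed.

Lemma elog_part_le (r : R) (N : nat) : 0 < r < 1 -> elog_part r N <= elog r.
Proof.
  intros Hr; apply is_lim_seq_incr_compare; [now apply elog_is_lim|].
  intros; now apply elog_part_incr.
Qed.

(* One block of [k] consecutive exponents; at [r^(b k)] the cyclotomic identity is exact. *)
Lemma log_block (k : nat) (w : C) (c r : R) (b : nat) :
  primitive_root k w -> 0 < c ->
  (forall j x, (0 < j < k)%nat -> 0 <= x <= 1 -> c <= Cmod (RtoC 1 - w ^ j * RtoC x)) ->
  0 < r < 1 -> (0 < b)%nat ->
  Rabs (rsum (fun j => ln (Cmod (RtoC 1 - (w * RtoC r) ^ (b * k + j)))) k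
        - ln (1 - (r ^ (k * k)) ^ b))
  <= INR k * ((r ^ (b * k) - r ^ (S b * k)) / c).
Proof.
  intros Hw Hc Hgap Hr Hb.
  assert (Hk : (0 < k)%nat) by apply Hw.
  assert (W1 := primitive_root_Cmod k w Hw).
  set (X := r ^ (b * k)).
  assert (HX : 0 < X < 1) by (apply pow_pos_in_01; trivial; nia).
  assert (Hpos : forall j, (j < k)%nat -> 0 < Cmod (RtoC 1 - w ^ j * RtoC X)).
  { intros [|j] Hj.
    - replace (RtoC 1 - w ^ 0 * RtoC X)%C with (RtoC (1 - X))
        by (rewrite RtoC_minus; simpl; ring).
      rewrite Cmod_R, Rabs_pos_eq; lra.
    - apply Rlt_le_trans with (1 := Hc); apply Hgap; [lia | lra]. }
  replace (ln (1 - (r ^ (k * k)) ^ b))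
    with (rsum (fun j => ln (Cmod (RtoC 1 - w ^ j * RtoC X))) k).
  2:{ rewrite <- (proj2 (ln_Cmod_cprod _ k Hpos)), cprod_cyclotomic by trivial.
      rewrite <- RtoC_pow, <- RtoC_minus, Cmod_R, Rabs_pos_eq
        by (generalize (pow_in_01 X k HX); lra).
      unfold X; rewrite <- !pow_mult; do 3 f_equal; lia. }
  apply rsum_close; intros j Hj.
  (* Since [w ^ (b k) = 1], only the radius distinguishes this factor from the one taken at
     [X = r ^ (b k)]. *)
  replace ((w * RtoC r) ^ (b * k + j))%C with (w ^ j * RtoC (r ^ (b * k + j)))%C.
  2:{ rewrite Cpow_mult_l, RtoC_pow; f_equal.
      rewrite Cpow_add_r, Nat.mul_comm, Cpow_mult_r, (proj1 (proj2 Hw)), Cpow_1_l; ring. }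
  assert (Hd : r ^ (S b * k) <= r ^ (b * k + j) <= X).
  { split.
    - replace (S b * k)%nat with ((b * k + j) + (k - j))%nat by lia.
      rewrite (pow_add _ (b * k + j)).
      generalize (pow_in_01 r (b * k + j) Hr) (pow_in_01 r (k - j) Hr); nra.
    - rewrite pow_add; fold X; generalize (pow_in_01 r j Hr); nra. }
  destruct j as [|j].
  - rewrite Nat.add_0_r; fold X; rewrite Rminus_diag, Rabs_R0.
    apply Rdiv_le_0_compat; [|trivial]; rewrite Nat.add_0_r in Hd; lra.
  - eapply Rle_trans; [apply ln_lipschitz with (c := c); trivial|].
    + apply Hgap; [lia|].
      generalize (pow_in_01 r (b * k + S j) Hr); lra.
    + apply Hgap; [lia | lra].
    + apply Rmult_le_compat_r; [left; now apply Rinv_0_lt_compat|].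
      apply Rle_trans with (Cmod (w ^ (S j) * RtoC (X - r ^ (b * k + S j)))).
      * replace (w ^ S j * RtoC (X - r ^ (b * k + S j)))%C with
          ((RtoC 1 - w ^ S j * RtoC (r ^ (b * k + S j))) - (RtoC 1 - w ^ S j * RtoC X))%C
          by (rewrite RtoC_minus; ring).
        apply Cmod_triangle_rev.
      * rewrite Cmod_mult, Cmod_pow, W1, pow1, Cmod_R, Rabs_pos_eq by lra; lra.
Qed.

(** The [k - 1] factors before the first full block contribute a bounded amount by the gap. The
    block errors telescope to [r ^ k - r ^ (S B * k) <= 1], so the bound is uniform in [r] and
    [B]. *)
Lemma log_partial_bound (k : nat) (w : C) :
  primitive_root k w ->
  exists K, forall r B, 0 < r < 1 ->
    (forall n, 0 < Cmod (RtoC 1 - (w * RtoC r) ^ (S n))) /\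
    Rabs (rsum (fun n => ln (Cmod (RtoC 1 - (w * RtoC r) ^ (S n)))) (k - 1 + B * k)
          + elog_part (r ^ (k * k)) B) <= K.
Proof.
  intros Hw.
  assert (Hk : (0 < k)%nat) by apply Hw.
  assert (W1 := primitive_root_Cmod k w Hw).
  destruct (primitive_root_gap k w Hw) as (c & Hc & Hgap).
  exists (INR (k - 1) * ((1 / c)) + INR k / c).
  intros r B Hr; split.
  { intros n; apply Cmod_gt_0; intros E.
    assert (E2 : Cmod ((w * RtoC r) ^ S n) = 1).
    { replace ((w * RtoC r) ^ S n)%C with (RtoC 1 - (RtoC 1 - (w * RtoC r) ^ S n))%C by ring.
      rewrite E; replace (RtoC 1 - RtoC 0)%C with (RtoC 1) by ring; apply Cmod_1. }
    rewrite Cmod_pow, Cmod_mult, W1, Cmod_R, Rabs_pos_eq, Rmult_1_l in E2 by lra.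
    generalize (pow_S_in_01 r n Hr); lra. }
  assert (H0 : Rabs (rsum (fun n => ln (Cmod (RtoC 1 - (w * RtoC r) ^ (S n)))) (k - 1))
               <= INR (k - 1) * (1 / c)).
  (* Each initial logarithm is compared with [ln 1 = 0]; the exponents 1 to [k - 1] all fall under
     the gap. *)
  { replace (rsum (fun n => ln (Cmod (RtoC 1 - (w * RtoC r) ^ (S n)))) (k - 1))
      with (rsum (fun n => ln (Cmod (RtoC 1 - (w * RtoC r) ^ (S n)))) (k - 1)
            - rsum (fun _ => 0) (k - 1)).
    2:{ replace (rsum (fun _ => 0) (k - 1)) with 0; [ring|].
        clear; induction (k - 1)%nat as [|m IH]; simpl; lra. }
    apply rsum_close; intros i Hi.
    rewrite Cpow_mult_l, <- RtoC_pow.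
    rewrite <- ln_1.
    assert (P := pow_S_in_01 r i Hr).
    eapply Rle_trans; [apply ln_lipschitz with (c := c); try lra|].
    { apply Hgap; [lia | lra]. }
    apply Rmult_le_compat_r; [left; apply Rinv_0_lt_compat; lra|].
    generalize (Cmod_triangle_rev (RtoC 1 - w ^ S i * RtoC (r ^ S i)) (RtoC 1)).
    rewrite Cmod_1; intros T; eapply Rle_trans; [apply T|].
    replace (RtoC 1 - w ^ S i * RtoC (r ^ S i) - RtoC 1)%C
      with (- (w ^ S i * RtoC (r ^ S i)))%C by ring.
    rewrite Cmod_opp, Cmod_mult, Cmod_pow, W1, pow1, Cmod_R, Rabs_pos_eq; lra. }
  assert (H : Rabs (rsum (fun n => ln (Cmod (RtoC 1 - (w * RtoC r) ^ (S n)))) (k - 1 + B * k)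
          + elog_part (r ^ (k * k)) B)
     <= INR (k - 1) * (1 / c) + INR k * ((r ^ k - r ^ (S B * k)) / c)).
  { induction B as [|B IH].
    - unfold elog_part; cbn [rsum]; rewrite Nat.mul_1_l, Nat.mul_0_l, Nat.add_0_r, Rplus_0_r.
      replace (INR k * ((r ^ k - r ^ k) / c)) with 0 by (field; lra); lra.
    - replace (k - 1 + S B * k)%nat with ((k - 1 + B * k) + k)%nat by (simpl; lia).
      rewrite rsum_add.
      change (elog_part (r ^ (k * k)) (S B)) with
        (elog_part (r ^ (k * k)) B + - ln (1 - (r ^ (k * k)) ^ S B)).
      rewrite (rsum_ext (fun i => ln (Cmod (RtoC 1 - (w * RtoC r) ^ S (k - 1 + B * k + i))))
        (fun j => ln (Cmod (RtoC 1 - (w * RtoC r) ^ (S B * k + j))))).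
      2:{ intros i Hi; do 4 f_equal; simpl; lia. }
      generalize (log_block k w c r (S B) Hw (proj1 Hc) Hgap Hr ltac:(lia)).
      set (u := rsum _ k); set (v := ln _).
      intros Hblock.
      match goal with |- Rabs (?a + u + (?b + - v)) <= _ =>
        replace (a + u + (b + - v)) with ((a + b) + (u - v)) by ring end.
      eapply Rle_trans; [apply Rabs_triang|].
      eapply Rle_trans; [apply Rplus_le_compat; [apply IH | apply Hblock]|].
      right; field; lra. }
  eapply Rle_trans; [apply H|].
  apply Rplus_le_compat_l, Rmult_le_compat_l; [apply pos_INR|].
  rewrite <- (Rmult_1_l (/ c)).
  apply Rmult_le_compat_r; [left; apply Rinv_0_lt_compat; lra|].
  generalize (pow_in_01 r k Hr) (pow_in_01 r (S B * k) Hr); lra.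
Qed.

(** * Convergence of the eta product and its size above a rational point *)

Lemma cpow_Cpow (z : C) (n : nat) : cpow z n = (z ^ n)%C.
Proof. induction n as [|n IH]; simpl; trivial; now rewrite IH. Qed.

Lemma eta_prod_cprod (tau : C) (N : nat) :
  eta_prod tau N = cprod (fun n => RtoC 1 - qpar tau ^ (S n))%C N.
Proof.
  induction N as [|N IH]; trivial.
  change (eta_prod tau (S N)) with (eta_prod tau N * (RtoC 1 - cpow (qpar tau) (S N)))%C.
  now rewrite IH, cpow_Cpow.
Qed.

(** Each factor has modulus at most [1 + r ^ n <= exp (r ^ n)], and the exponents form a geometric
    sum. *)
Lemma Cmod_cprod_bound (q : C) (r : R) (N : nat) :
  Cmod q = r -> 0 < r < 1 ->
  Cmod (cprod (fun n => RtoC 1 - q ^ (S n))%C N) <= exp (r / (1 - r)).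
Proof.
  intros Hq Hr.
  apply Rle_trans with (exp (r / (1 - r) * (1 - r ^ N))).
  - induction N as [|N IH].
    + simpl cprod; simpl pow; rewrite Rminus_diag, Rmult_0_r, exp_0, Cmod_1; lra.
    + simpl cprod; rewrite Cmod_mult.
      replace (r / (1 - r) * (1 - r ^ S N)) with (r / (1 - r) * (1 - r ^ N) + r ^ S N)
        by (simpl; field; lra).
      rewrite exp_plus; apply Rmult_le_compat; try apply Cmod_ge_0; trivial.
      eapply Rle_trans; [|apply exp_ineq1_le].
      unfold Cminus; eapply Rle_trans; [apply Cmod_triangle|].
      rewrite Cmod_opp, Cmod_1, <- Cpow_S, Cmod_pow, Hq; lra.
  - assert (H : 0 < r / (1 - r)) by (apply Rdiv_lt_0_compat; lra).
    assert (H' : r / (1 - r) * (1 - r ^ N) <= r / (1 - r)).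
    { generalize (pow_in_01 r N Hr); nra. }
    destruct H' as [H'|H']; [left; now apply exp_increasing | right; now f_equal].
Qed.

(** Subtracting [B r / (1 - r) * r ^ n], which is the tail of the increment bounds, makes the
    sequence increasing and bounded; the subtracted term tends to 0. *)
Lemma ex_lim_of_geometric_increments (u : nat -> R) (B r : R) :
  0 < r < 1 -> 0 <= B ->
  (forall n, Rabs (u (S n) - u n) <= B * r ^ (S n)) -> ex_finite_lim_seq u.
Proof.
  intros Hr HB Hu.
  assert (Hb : forall n, u n <= u 0%nat + B * r / (1 - r) * (1 - r ^ n)).
  { induction n as [|n IH]; [simpl; lra|].
    generalize (Rle_trans _ _ _ (Rle_abs _) (Hu n)).
    replace (B * r / (1 - r) * (1 - r ^ S n)) with
      (B * r / (1 - r) * (1 - r ^ n) + B * r ^ S n) by (simpl; field; lra).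
    lra. }
  assert (HBr : 0 <= B * r / (1 - r)) by (apply Rdiv_le_0_compat; nra).
  destruct (ex_finite_lim_seq_incr (fun n => u n - B * r / (1 - r) * r ^ n)
              (u 0%nat + B * r / (1 - r))) as [l Hl].
  - intros n.
    generalize (Hu n); intros H; apply Rabs_le_between in H.
    replace (B * r / (1 - r) * r ^ S n) with
      (B * r / (1 - r) * r ^ n - B * r ^ S n) by (simpl; field; lra).
    lra.
  - intros n; generalize (Hb n) (pow_in_01 r n Hr); nra.
  - exists (l + B * r / (1 - r) * 0).
    apply is_lim_seq_ext with
      (fun n => (u n - B * r / (1 - r) * r ^ n) + B * r / (1 - r) * r ^ n).
    + intros; ring.
    + apply is_lim_seq_plus'; trivial.
      apply (is_lim_seq_scal_l _ _ 0), is_lim_seq_geom.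
      rewrite Rabs_pos_eq; lra.
Qed.

Lemma Im_le_Cmod (z : C) : Rabs (Im z) <= Cmod z.
Proof. eapply Rle_trans; [apply Rmax_r | apply Rmax_Cmod]. Qed.

(** As [eta_inf] is a limit taken coordinate by coordinate, both coordinates must be shown to
    converge. Consecutive partial products differ by a geometrically small amount, and the modulus
    is continuous in the coordinates. *)
Lemma eta_inf_Cmod_lim (tau : C) :
  0 < Cmod (qpar tau) < 1 ->
  is_lim_seq (fun N => Cmod (eta_prod tau N)) (Cmod (eta_inf tau)).
Proof.
  set (r := Cmod (qpar tau)); intros Hr.
  assert (Hd : forall n, Cmod (eta_prod tau (S n) - eta_prod tau n)
                         <= exp (r / (1 - r)) * r ^ S n).
  { intros n.
    change (eta_prod tau (S n)) with (eta_prod tau n * (RtoC 1 - cpow (qpar tau) (S n)))%C.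
    replace (eta_prod tau n * (RtoC 1 - cpow (qpar tau) (S n)) - eta_prod tau n)%C
      with (- (eta_prod tau n * cpow (qpar tau) (S n)))%C by ring.
    rewrite Cmod_opp, Cmod_mult, cpow_Cpow, Cmod_pow, eta_prod_cprod.
    apply Rmult_le_compat_r; [left; apply pow_lt, Hr|].
    now apply Cmod_cprod_bound. }
  assert (HB : 0 <= exp (r / (1 - r))) by (left; apply exp_pos).
  assert (HRe : is_lim_seq (fun N => Re (eta_prod tau N)) (Re (eta_inf tau))).
  { apply Lim_seq_correct', (ex_lim_of_geometric_increments _ _ r Hr HB).
    intros n; eapply Rle_trans; [|apply Hd].
    apply (re_le_Cmod (eta_prod tau (S n) - eta_prod tau n)). }
  assert (HIm : is_lim_seq (fun N => Im (eta_prod tau N)) (Im (eta_inf tau))).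
  { apply Lim_seq_correct', (ex_lim_of_geometric_increments _ _ r Hr HB).
    intros n; eapply Rle_trans; [|apply Hd].
    apply (Im_le_Cmod (eta_prod tau (S n) - eta_prod tau n)). }
  apply (is_lim_seq_continuous sqrt
           (fun N => Re (eta_prod tau N) ^ 2 + Im (eta_prod tau N) ^ 2)).
  - apply continuity_pt_sqrt; unfold fst, snd; nra.
  - assert (sq : forall u (l : R), is_lim_seq u l -> is_lim_seq (fun n => u n ^ 2) (l ^ 2)).
    { intros u l H; apply is_lim_seq_ext with (fun n => u n * u n); [intros; ring|].
      replace (l ^ 2) with (l * l) by ring; now apply is_lim_seq_mult'. }
    apply is_lim_seq_plus'; now apply sq.
Qed.

Lemma cexp_imag_pow (t : R) (n : nat) : (cexp (0, t) ^ n)%C = cexp (0, INR n * t).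
Proof.
  induction n as [|n IH].
  - unfold cexp; simpl; rewrite Rmult_0_l, exp_0, cos_0, sin_0.
    apply injective_projections; simpl; ring.
  - rewrite Cpow_S, IH, S_INR.
    replace ((INR n + 1) * t) with (t + INR n * t) by ring.
    unfold cexp, Cmult; simpl; rewrite exp_0, cos_plus, sin_plus.
    apply injective_projections; simpl; ring.
Qed.

Lemma cos_eq_1_period (x : R) : cos (2 * PI * x) = 1 -> exists z : Z, x = IZR z.
Proof.
  intros H.
  replace (2 * PI * x) with (2 * (PI * x)) in H by ring.
  rewrite cos_2a_sin in H.
  destruct (sin_eq_0_0 (PI * x)) as [z Hz]; [nra|].
  exists z; apply Rmult_eq_reg_l with PI; [lra | apply PI_neq0].
Qed.

(** If the power [j] equals 1, then [j h / k] is an integer; by Gauss [k] divides [j], which is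
    impossible for [0 < j < k]. *)
Lemma cexp_primitive_root (h k : nat) :
  (0 < k)%nat -> Nat.gcd k h = 1%nat ->
  primitive_root k (cexp (0, 2 * PI * (INR h / INR k))).
Proof.
  intros Hk Hg.
  assert (Hk' : 0 < INR k) by now apply lt_0_INR.
  split; [trivial | split].
  - rewrite cexp_imag_pow; unfold cexp; simpl.
    replace (INR k * (2 * PI * (INR h / INR k))) with (0 + 2 * INR h * PI) by (field; lra).
    rewrite cos_period, sin_period, exp_0, cos_0, sin_0; apply injective_projections; simpl; ring.
  - intros j Hj E.
    rewrite cexp_imag_pow in E; apply (f_equal Re) in E; unfold cexp in E; simpl in E.
    rewrite exp_0, Rmult_1_l in E.
    replace (INR j * (2 * PI * (INR h / INR k)))
      with (2 * PI * (INR j * INR h / INR k)) in E by (field; lra).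
    apply cos_eq_1_period in E; destruct E as [z Hz].
    assert (E : (Z.of_nat (h * j) = z * Z.of_nat k)%Z).
    { apply eq_IZR; rewrite mult_IZR, <- !INR_IZR_INZ, mult_INR, <- Hz; field; lra. }
    assert (D : Nat.divide k (h * j)).
    { exists (Z.to_nat z); nia. }
    apply Nat.gauss in D; trivial.
    apply Nat.divide_pos_le in D; lia.
Qed.

(** At [h/k + i s/(2 pi)] the parameter [q] equals [w * exp (- s)] with [w] a primitive [k]-th root
    of unity. The term [s / 24] comes from the prefactor [q^(1/24)], and [K] does not depend on
    [s]. *)
Lemma eta_growth (h k : nat) :
  (0 < k)%nat -> Nat.gcd k h = 1%nat ->
  exists K, forall s, 0 < s ->
    0 < Cmod (dedekind_eta (INR h / INR k, s / (2 * PI))) /\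
    Rabs (ln (Cmod (dedekind_eta (INR h / INR k, s / (2 * PI))))
          + s / 24 + elog (exp (- s) ^ (k * k))) <= K.
Proof.
  intros Hk Hg.
  set (w := cexp (0, 2 * PI * (INR h / INR k))).
  assert (Hw : primitive_root k w) by now apply cexp_primitive_root.
  destruct (log_partial_bound k w Hw) as [K HK].
  exists K; intros s Hs.
  set (tau := (INR h / INR k, s / (2 * PI)) : C).
  assert (HPI := PI_RGT_0).
  set (r := exp (- s)).
  assert (Hr : 0 < r < 1).
  { split; [apply exp_pos|].
    rewrite <- exp_0; apply exp_increasing; lra. }
  assert (Hq : qpar tau = (w * RtoC r)%C).
  { unfold qpar, tau, w, r, cexp, Cmult, RtoC, Ci; simpl.
    match goal with |- (exp ?a * cos ?b, _) = _ =>
      replace a with (- s) by (field; split; [apply Rgt_not_eq, lt_0_INR, Hk | lra]);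
      replace b with (2 * PI * (INR h / INR k))
        by (field; split; [lra | apply Rgt_not_eq, lt_0_INR, Hk])
    end.
    rewrite exp_0; apply injective_projections; simpl; ring. }
  assert (Hmq : Cmod (qpar tau) = r).
  { rewrite Hq, Cmod_mult, (primitive_root_Cmod k w Hw), Cmod_R, Rabs_pos_eq; lra. }
  (* The limit is read along the lengths [k - 1 + B k], which consist of whole blocks. *)
  assert (Hlim : is_lim_seq (fun B => Cmod (eta_prod tau (k - 1 + B * k))) (Cmod (eta_inf tau))).
  { apply (is_lim_seq_subseq (fun N => Cmod (eta_prod tau N)) _ (fun B => k - 1 + B * k)%nat).
    - apply eventually_subseq; intros; nia.
    - apply eta_inf_Cmod_lim; rewrite Hmq; trivial. }
  assert (Hpart : forall B, 0 < Cmod (eta_prod tau (k - 1 + B * k)) /\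
     Rabs (ln (Cmod (eta_prod tau (k - 1 + B * k))) + elog_part (r ^ (k * k)) B) <= K).
  { intros B; destruct (HK r B Hr) as [H1 H2].
    rewrite eta_prod_cprod, Hq.
    destruct (ln_Cmod_cprod (fun n => RtoC 1 - (w * RtoC r) ^ (S n))%C (k - 1 + B * k)) as [H3 H4].
    - intros; apply H1.
    - split; trivial; rewrite H4; trivial. }
  assert (Hrk : 0 < r ^ (k * k) < 1) by (apply pow_pos_in_01; trivial; nia).
  (* The partial products stay above a positive bound independent of [B], because [elog_part] never
     exceeds [elog]. *)
  assert (Hpos : 0 < Cmod (eta_inf tau)).
  { apply Rlt_le_trans with (exp (- K - elog (r ^ (k * k)))); [apply exp_pos|].
    apply (is_lim_seq_le (fun _ => exp (- K - elog (r ^ (k * k)))) _ _ _)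
      with (2 := is_lim_seq_const _) (3 := Hlim).
    intros B; destruct (Hpart B) as [H1 H2].
    rewrite <- (exp_ln (Cmod _)) by trivial.
    apply Rabs_le_between in H2.
    generalize (elog_part_le (r ^ (k * k)) B Hrk); intros H3.
    destruct (Rle_lt_or_eq_dec (- K - elog (r ^ (k * k))) (ln (Cmod (eta_prod tau (k - 1 + B * k))))) as [E|E];
      [lra | left; now apply exp_increasing | rewrite E; lra]. }
  assert (Heta : dedekind_eta tau
                 = (cexp (Cmult (RtoC (2 * PI / 24)) (Cmult Ci tau)) * eta_inf tau)%C)
    by trivial.
  assert (Hpre : Cmod (cexp (Cmult (RtoC (2 * PI / 24)) (Cmult Ci tau))) = exp (- (s / 24))).
  { set (z := Cmult _ _).
    replace (cexp z) with (RtoC (exp (Re z)) * cexp (0, Im z))%C.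
    2:{ unfold cexp, Cmult, RtoC; simpl; rewrite exp_0, Rmult_1_l; apply injective_projections; simpl; ring. }
    rewrite Cmod_mult, Cmod_R, Rabs_pos_eq by (left; apply exp_pos).
    replace (Cmod (cexp (0, Im z))) with 1.
    - rewrite Rmult_1_r; f_equal; unfold z, tau; simpl; field.
      split; [apply Rgt_not_eq, lt_0_INR, Hk | lra].
    - generalize (Im z) as t; intros t; unfold cexp, Cmod; cbn [fst snd Re Im].
      rewrite exp_0, !Rmult_1_l, <- !Rsqr_pow2, Rplus_comm, sin2_cos2.
      symmetry; apply sqrt_1. }
  rewrite Heta, Cmod_mult, Hpre; split.
  - apply Rmult_lt_0_compat; [apply exp_pos | trivial].
  - rewrite ln_mult, ln_exp by (trivial; apply exp_pos).
    replace (- (s / 24) + ln (Cmod (eta_inf tau)) + s / 24 + elog (r ^ (k * k)))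
      with (ln (Cmod (eta_inf tau)) + elog (r ^ (k * k))) by ring.
    assert (HL : is_lim_seq
       (fun B => ln (Cmod (eta_prod tau (k - 1 + B * k))) + elog_part (r ^ (k * k)) B)
       (ln (Cmod (eta_inf tau)) + elog (r ^ (k * k)))).
    { apply is_lim_seq_plus'; [|now apply elog_is_lim].
      apply (is_lim_seq_continuous ln _ _); trivial.
      apply derivable_continuous_pt; exists (/ Cmod (eta_inf tau)).
      now apply derivable_pt_lim_ln. }
    apply is_lim_seq_abs in HL.
    apply (is_lim_seq_le _ (fun _ => K) _ K (fun B => proj2 (Hpart B)) HL).
    apply is_lim_seq_const.
Qed.

(** * Scaling along a common sequence *)

Lemma rsum_le (f g : nat -> R) (n : nat) :
  (forall i, (i < n)%nat -> f i <= g i) -> rsum f n <= rsum g n.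
Proof.
  induction n as [|n IH]; intros H; simpl; [lra|].
  apply Rplus_le_compat; [apply IH; intros; apply H; lia | apply H; lia].
Qed.

Lemma rsum_const (c : R) (n : nat) : rsum (fun _ => c) n = INR n * c.
Proof. induction n as [|n IH]; [simpl; ring|]; simpl rsum; rewrite IH, S_INR; ring. Qed.

Lemma opp_ln_pow_antitone (r : R) (n m : nat) :
  0 < r < 1 -> (0 < n <= m)%nat -> - ln (1 - r ^ m) <= - ln (1 - r ^ n).
Proof.
  intros Hr Hn; apply Ropp_le_contravar.
  assert (H1 := pow_pos_in_01 r n (proj1 Hn) Hr).
  assert (H2 : r ^ m <= r ^ n).
  { replace m with (n + (m - n))%nat by lia; rewrite pow_add.
    generalize (pow_in_01 r (m - n) Hr); nra. }
  destruct H2 as [H2|H2]; [left; apply ln_increasing; lra | rewrite H2; lra].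
Qed.

Lemma elog_subseq_lim (r : R) (a c : nat) :
  (0 < a)%nat -> 0 < r < 1 -> is_lim_seq (fun B => elog_part r (c + a * B)) (elog r).
Proof.
  intros Ha Hr; apply (is_lim_seq_subseq (elog_part r) _ (fun B => c + a * B)%nat).
  - apply eventually_subseq; intros; nia.
  - now apply elog_is_lim.
Qed.

(* The terms of [elog r] decrease, so blocks of [a] of them compare with the terms of [elog (r^a)]. *)
Lemma elog_scaling (r : R) (a : nat) :
  (0 < a)%nat -> 0 < r < 1 ->
  INR a * elog (r ^ a) <= elog r <= INR a * elog (r ^ a) + INR a * - ln (1 - r).
Proof.
  intros Ha Hr.
  assert (Hra := pow_pos_in_01 r a Ha Hr).
  assert (Hl : is_lim_seq (fun B => INR a * elog_part (r ^ a) B) (INR a * elog (r ^ a))).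
  { apply (is_lim_seq_scal_l _ _ (elog (r ^ a))); now apply elog_is_lim. }
  split.
  - refine (is_lim_seq_le (fun B => INR a * elog_part (r ^ a) B) _
      (INR a * elog (r ^ a)) (elog r) _ Hl (elog_subseq_lim r a 0 Ha Hr)).
    intros B; rewrite Nat.add_0_l.
    induction B as [|B IH]; [rewrite Nat.mul_0_r; unfold elog_part; simpl; lra|].
    rewrite Nat.mul_succ_r; unfold elog_part in *; rewrite rsum_add.
    cbn [rsum]; rewrite Rmult_plus_distr_l, <- (rsum_const (- ln (1 - (r ^ a) ^ S B)) a).
    apply Rplus_le_compat; [apply IH|].
    apply rsum_le; intros i Hi; rewrite <- pow_mult; apply opp_ln_pow_antitone; trivial; nia.
  - refine (is_lim_seq_le _ (fun B => INR a * elog_part (r ^ a) B + INR a * - ln (1 - r))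
      (elog r) (INR a * elog (r ^ a) + INR a * - ln (1 - r)) _ (elog_subseq_lim r a a Ha Hr) _).
    2:{ apply is_lim_seq_plus'; [trivial | apply is_lim_seq_const]. }
    intros B; induction B as [|B IH].
    + rewrite Nat.mul_0_r, Nat.add_0_r; unfold elog_part; cbn [rsum].
      rewrite Rmult_0_r, Rplus_0_l, <- (rsum_const _ a).
      apply rsum_le; intros i Hi.
      rewrite <- (pow_1 r) at 2; apply opp_ln_pow_antitone; trivial; lia.
    + replace (a + a * S B)%nat with ((a + a * B) + a)%nat by lia.
      unfold elog_part in *; rewrite rsum_add; cbn [rsum].
      (* For the upper bound the blocks are shifted by [a]: the first [a] terms are absorbed by
         [- ln (1 - r)], and block [S B] has exponents above [a * S B]. *)
      assert (H : rsum (fun i => - ln (1 - r ^ S (a + a * B + i))) a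
                  <= INR a * - ln (1 - (r ^ a) ^ S B)).
      { rewrite <- (rsum_const _ a); apply rsum_le; intros i Hi.
        rewrite <- pow_mult; apply opp_ln_pow_antitone; trivial; nia. }
      lra.
Qed.

(** One sequence of heights serves every cusp, and [scale] is the common unit in which all
    logarithms of eta and [gfun] are measured. *)
Definition s_seq (n : nat) : R := / INR (S n).
Definition r_seq (n : nat) : R := exp (- s_seq n).
Definition scale (n : nat) : R := elog (r_seq n).

Lemma s_seq_pos (n : nat) : 0 < s_seq n.
Proof. apply Rinv_0_lt_compat, lt_0_INR; lia. Qed.

Lemma s_seq_le_1 (n : nat) : s_seq n <= 1.
Proof.
  unfold s_seq; rewrite <- Rinv_1; apply Rinv_le_contravar; [lra|].
  rewrite S_INR; generalize (pos_INR n); lra.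
Qed.

Lemma r_seq_in_01 (n : nat) : 0 < r_seq n < 1.
Proof.
  split; [apply exp_pos|].
  rewrite <- exp_0; apply exp_increasing; generalize (s_seq_pos n); lra.
Qed.

Lemma exp_pow_nat (x : R) (n : nat) : exp x ^ n = exp (INR n * x).
Proof.
  induction n as [|n IH]; [simpl; now rewrite Rmult_0_l, exp_0|].
  rewrite <- tech_pow_Rmult, IH, <- exp_plus, S_INR; f_equal; ring.
Qed.

Lemma exp_m1_in_01 : 0 < exp (-1) < 1.
Proof. split; [apply exp_pos | rewrite <- exp_0; apply exp_increasing; lra]. Qed.

(** For [i <= n + 1] one has [i * s_seq n <= 1], so each of the first [n + 1] terms is at least
    [- ln (1 - exp (-1))]. *)
Lemma scale_lower (n : nat) : INR (S n) * - ln (1 - exp (-1)) <= scale n.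
Proof.
  eapply Rle_trans; [|apply (elog_part_le _ (S n)), r_seq_in_01].
  unfold elog_part; rewrite <- rsum_const; apply rsum_le; intros i Hi.
  apply Ropp_le_contravar.
  assert (H := pow_S_in_01 _ i (r_seq_in_01 n)).
  assert (H' : exp (-1) <= r_seq n ^ S i).
  { unfold r_seq; rewrite exp_pow_nat.
    assert (L : -1 <= INR (S i) * - s_seq n).
    { assert (INR (S i) * s_seq n <= 1); [|lra].
      unfold s_seq; apply Rmult_le_reg_r with (INR (S n)); [apply lt_0_INR; lia|].
      rewrite Rmult_assoc, Rinv_l, Rmult_1_r, Rmult_1_l by (apply not_0_INR; lia).
      apply le_INR; lia. }
    destruct L as [L|L]; [left; now apply exp_increasing | rewrite <- L; lra]. }
  generalize exp_m1_in_01; intros H1.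
  destruct H' as [H'|H']; [left; apply ln_increasing; lra | rewrite H'; lra].
Qed.

Lemma scale_pos (n : nat) : 0 < scale n.
Proof.
  eapply Rlt_le_trans; [|apply scale_lower].
  apply Rmult_lt_0_compat; [apply lt_0_INR; lia | apply opp_ln_bounds, exp_m1_in_01].
Qed.

Lemma is_lim_seq_INR_S : is_lim_seq (fun n => INR (S n)) p_infty.
Proof. apply (is_lim_seq_incr_1 INR), is_lim_seq_INR. Qed.

Lemma scale_lim : is_lim_seq scale p_infty.
Proof.
  apply is_lim_seq_le_p_loc with (fun n => INR (S n) * - ln (1 - exp (-1))).
  - exists 0%nat; intros; apply scale_lower.
  - set (c := - ln _).
    assert (Hc : 0 < c) by apply opp_ln_bounds, exp_m1_in_01.
    replace p_infty with (Rbar_mult p_infty c).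
    + apply is_lim_seq_scal_r, is_lim_seq_INR_S.
    + apply is_Rbar_mult_unique, is_Rbar_mult_p_infty_pos; exact Hc.
Qed.

Lemma bounded_div_scale (e : nat -> R) (K : R) :
  (forall n, Rabs (e n) <= K) -> is_lim_seq (fun n => e n / scale n) 0.
Proof.
  intros H; apply is_lim_seq_abs_0.
  assert (Hl : is_lim_seq (fun n => K * / scale n) 0).
  { replace (Finite 0) with (Rbar_mult K 0) by (simpl; f_equal; ring).
    apply is_lim_seq_scal_l.
    replace (Finite 0) with (Rbar_inv p_infty) by trivial.
    apply is_lim_seq_inv; [apply scale_lim | discriminate]. }
  apply is_lim_seq_le_le with (2 := is_lim_seq_const 0) (3 := Hl).
  intros n; split; [apply Rabs_pos|].
  unfold Rdiv; rewrite Rabs_mult, (Rabs_pos_eq (/ _))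
    by (left; apply Rinv_0_lt_compat, scale_pos).
  apply Rmult_le_compat_r; [left; apply Rinv_0_lt_compat, scale_pos | apply H].
Qed.

(** This removes the error term of [elog_scaling]: it is at most logarithmic in [n], while [scale]
    grows at least linearly. *)
Lemma first_term_div_scale : is_lim_seq (fun n => - ln (1 - r_seq n) / scale n) 0.
Proof.
  set (c := - ln (1 - exp (-1))).
  assert (Hc : 0 < c) by apply opp_ln_bounds, exp_m1_in_01.
  assert (Hl : is_lim_seq (fun n => (2 / c) * (ln (INR (S (S n))) / INR (S (S n)))) 0).
  { replace (Finite 0) with (Rbar_mult (2 / c) 0) by (simpl; f_equal; ring).
    apply is_lim_seq_scal_l.
    apply (is_lim_comp_seq (fun y => ln y / y) _ p_infty 0 is_lim_div_ln_p).
    - exists 0%nat; intros; discriminate.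
    - apply (is_lim_seq_incr_1 (fun n => INR (S n))), is_lim_seq_INR_S. }
  apply is_lim_seq_le_le with (2 := is_lim_seq_const 0) (3 := Hl).
  intros n; assert (Hr := r_seq_in_01 n); assert (Hs := scale_pos n).
  assert (HS : 0 < INR (S n)) by (apply lt_0_INR; lia).
  split.
  - apply Rdiv_le_0_compat; trivial; left; now apply opp_ln_bounds.
  - assert (H1 : - ln (1 - r_seq n) <= ln (INR (S (S n)))).
    { rewrite <- ln_Rinv by lra.
      assert (H : / (1 - r_seq n) <= INR (S (S n))).
      (* From [exp s >= 1 + s] with [s = 1/(n+1)] one gets [1 / (1 - r) <= (1 + s) / s = n + 2]. *)
      { assert (E : r_seq n * (1 + s_seq n) <= 1).
        { unfold r_seq; rewrite exp_Ropp.
          apply Rmult_le_reg_l with (exp (s_seq n)); [apply exp_pos|].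
          rewrite <- Rmult_assoc, Rinv_r by (apply Rgt_not_eq, exp_pos).
          generalize (exp_ineq1_le (s_seq n)); lra. }
        assert (E2 : s_seq n * INR (S n) = 1) by (unfold s_seq; field; lra).
        rewrite (S_INR (S n)).
        apply Rmult_le_reg_l with (1 - r_seq n); [lra|].
        rewrite Rinv_r by lra; nra. }
      destruct H as [H|H];
        [left; apply ln_increasing; trivial; apply Rinv_0_lt_compat; lra | rewrite H; lra]. }
    (* Here [n + 1 >= (n + 2) / 2], which is the source of the constant [2 / c]. *)
    assert (H2 : INR (S (S n)) * c / 2 <= scale n).
    { eapply Rle_trans; [|apply scale_lower]; fold c.
      rewrite (S_INR (S n)).
      assert (1 <= INR (S n)) by (rewrite S_INR; generalize (pos_INR n); lra); nra. }
    assert (H0 : 0 < INR (S (S n))) by (apply lt_0_INR; lia).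
    apply Rle_trans with (ln (INR (S (S n))) / (INR (S (S n)) * c / 2)).
    + apply Rmult_le_compat; trivial.
      * left; now apply opp_ln_bounds.
      * left; now apply Rinv_0_lt_compat.
      * apply Rinv_le_contravar; trivial.
        apply Rdiv_lt_0_compat; [now apply Rmult_lt_0_compat | lra].
    + right; field; lra.
Qed.

Lemma elog_pow_div_scale (a : nat) :
  (0 < a)%nat -> is_lim_seq (fun n => elog (r_seq n ^ a) / scale n) (/ INR a).
Proof.
  intros Ha.
  assert (Ha' : 0 < INR a) by now apply lt_0_INR.
  apply is_lim_seq_le_le with
    (fun n => / INR a - - ln (1 - r_seq n) / scale n) (fun _ => / INR a).
  - intros n; generalize (elog_scaling (r_seq n) a Ha (r_seq_in_01 n)).
    fold (scale n); set (E := elog _); set (L := - ln _); intros [H1 H2].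
    assert (Hs := scale_pos n).
    split; (apply Rmult_le_reg_l with (INR a * scale n); [now apply Rmult_lt_0_compat|]).
    + replace (INR a * scale n * (/ INR a - L / scale n)) with (scale n - INR a * L)
        by (field; lra).
      replace (INR a * scale n * (E / scale n)) with (INR a * E) by (field; lra); lra.
    + replace (INR a * scale n * / INR a) with (scale n) by (field; lra).
      replace (INR a * scale n * (E / scale n)) with (INR a * E) by (field; lra); lra.
  - replace (Finite (/ INR a)) with (Finite (/ INR a - 0)) by (f_equal; ring).
    apply is_lim_seq_minus'; [apply is_lim_seq_const | apply first_term_div_scale].
  - apply is_lim_seq_const.
Qed.

(** * Rates of eta and of g at rational points *)

Definition reduced_fraction (x : R) (h k : nat) : Prop :=
  (0 < k)%nat /\ Nat.gcd k h = 1%nat /\ x = INR h / INR k.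

(** At height parameter [d s] the growth estimate involves [L(r ^ (d k^2))], which is asymptotic to
    [L(r) / (d k^2)]. The prefactor stays bounded because [s_seq n <= 1]. *)
Lemma eta_rate (x : R) (h k d : nat) :
  reduced_fraction x h k -> (0 < d)%nat ->
  (forall n, 0 < Cmod (dedekind_eta (x, INR d * s_seq n / (2 * PI)))) /\
  is_lim_seq (fun n => ln (Cmod (dedekind_eta (x, INR d * s_seq n / (2 * PI)))) / scale n)
    (- / (INR d * INR k ^ 2)).
Proof.
  intros (Hk & Hg & ->) Hd.
  destruct (eta_growth h k Hk Hg) as [K HK].
  assert (Hd' : 0 < INR d) by now apply lt_0_INR.
  assert (Hk' : 0 < INR k) by now apply lt_0_INR.
  assert (Hs : forall n, 0 < INR d * s_seq n)
    by (intros n; apply Rmult_lt_0_compat; [trivial | apply s_seq_pos]).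
  split; [intros n; apply (HK _ (Hs n))|].
  set (L := fun n => ln (Cmod (dedekind_eta (INR h / INR k, INR d * s_seq n / (2 * PI))))).
  set (E := fun n => elog (r_seq n ^ (d * (k * k)))).
  apply is_lim_seq_ext with (fun n => (L n + E n) / scale n - E n / scale n).
  { intros n; unfold L; field; apply Rgt_not_eq, scale_pos. }
  replace (Finite (- / (INR d * INR k ^ 2))) with (Finite (0 - / INR (d * (k * k)))).
  2:{ rewrite !mult_INR; f_equal; field; lra. }
  apply is_lim_seq_minus'.
  - apply bounded_div_scale with (K + INR d / 24).
    intros n; destruct (HK _ (Hs n)) as [_ H].
    replace (exp (- (INR d * s_seq n)) ^ (k * k)) with (r_seq n ^ (d * (k * k))) in H.
    2:{ unfold r_seq; rewrite !exp_pow_nat, !mult_INR; f_equal; ring. }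
    fold (E n) in H; fold (L n) in H.
    assert (B : 0 <= INR d * s_seq n <= INR d).
    { generalize (s_seq_pos n) (s_seq_le_1 n); nra. }
    apply Rabs_le_between in H; apply Rabs_le; lra.
  - apply elog_pow_div_scale; nia.
Qed.

(** The condition on [l] adds the rates of eta at [x], [2 x], [5 x] and [10 x], weighted by the
    exponents -4, 2, 4 and -2. The dilation by [c] also multiplies the height, whence the divisions
    by 2, 5 and 10. *)
Lemma gfun_rate (x l : R) (d h1 k1 h2 k2 h5 k5 h10 k10 : nat) :
  (0 < d)%nat ->
  reduced_fraction x h1 k1 -> reduced_fraction (2 * x) h2 k2 ->
  reduced_fraction (5 * x) h5 k5 -> reduced_fraction (10 * x) h10 k10 ->
  INR d * l = 4 / INR k1 ^ 2 - 1 / INR k2 ^ 2 - 4 / 5 / INR k5 ^ 2 + 1 / 5 / INR k10 ^ 2 ->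
  (forall n, 0 < Cmod (gfun (x, INR d * s_seq n / (2 * PI)))) /\
  is_lim_seq (fun n => ln (Cmod (gfun (x, INR d * s_seq n / (2 * PI)))) / scale n) l.
Proof.
  intros Hd F1 F2 F5 F10 Hl.
  destruct (eta_rate _ _ _ d F1 Hd) as [P1 L1].
  destruct (eta_rate _ _ _ (2 * d) F2 ltac:(lia)) as [P2 L2].
  destruct (eta_rate _ _ _ (5 * d) F5 ltac:(lia)) as [P5 L5].
  destruct (eta_rate _ _ _ (10 * d) F10 ltac:(lia)) as [P10 L10].
  assert (mul : forall c n, (RtoC (INR c) * (x, (INR d * s_seq n / (2 * PI))%R))%C
                 = (INR c * x, INR (c * d) * s_seq n / (2 * PI))).
  { intros c n; rewrite mult_INR.
    apply injective_projections; simpl; field; apply PI_neq0. }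
  assert (G : forall n,
    0 < Cmod (gfun (x, INR d * s_seq n / (2 * PI))) /\
    ln (Cmod (gfun (x, INR d * s_seq n / (2 * PI)))) =
      2 * ln (Cmod (dedekind_eta (2 * x, INR (2 * d) * s_seq n / (2 * PI))))
      + 4 * ln (Cmod (dedekind_eta (5 * x, INR (5 * d) * s_seq n / (2 * PI))))
      - 4 * ln (Cmod (dedekind_eta (x, INR d * s_seq n / (2 * PI))))
      - 2 * ln (Cmod (dedekind_eta (10 * x, INR (10 * d) * s_seq n / (2 * PI))))).
  { intros n; generalize (P1 n) (P2 n) (P5 n) (P10 n); intros Q1 Q2 Q5 Q10.
    unfold gfun.
    replace (RtoC 2) with (RtoC (INR 2)) by (f_equal; simpl; ring).
    replace (RtoC 5) with (RtoC (INR 5)) by (f_equal; simpl; ring).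
    replace (RtoC 10) with (RtoC (INR 10)) by (f_equal; simpl; ring).
    rewrite !mul.
    replace (INR 2) with 2 by (simpl; ring).
    replace (INR 5) with 5 by (simpl; ring).
    replace (INR 10) with 10 by (simpl; ring).
    rewrite !cpow_Cpow.
    set (e1 := dedekind_eta (x, _)) in *; set (e2 := dedekind_eta (2 * x, _)) in *.
    set (e5 := dedekind_eta (5 * x, _)) in *; set (e10 := dedekind_eta (10 * x, _)) in *.
    assert (N1 := pow_lt _ 4 Q1); assert (N2 := pow_lt _ 2 Q2).
    assert (N5 := pow_lt _ 4 Q5); assert (N10 := pow_lt _ 2 Q10).
    rewrite Cmod_div.
    2:{ apply Cmod_gt_0; rewrite Cmod_mult, !Cmod_pow; now apply Rmult_lt_0_compat. }
    rewrite !Cmod_mult, !Cmod_pow; split.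
    - apply Rdiv_lt_0_compat; now apply Rmult_lt_0_compat.
    - rewrite ln_div by now apply Rmult_lt_0_compat.
      rewrite !ln_mult by trivial.
      rewrite !ln_pow by trivial.
      simpl INR; ring. }
  split; [intros n; apply G|].
  set (u1 := fun n => _) in L1; set (u2 := fun n => _) in L2.
  set (u5 := fun n => _) in L5; set (u10 := fun n => _) in L10.
  apply is_lim_seq_ext with (fun n => 2 * u2 n + 4 * u5 n - 4 * u1 n - 2 * u10 n).
  { intros n; rewrite (proj2 (G n)); unfold u1, u2, u5, u10; field.
    apply Rgt_not_eq, scale_pos. }
  replace l with (2 * (- / (INR (2 * d) * INR k2 ^ 2)) + 4 * (- / (INR (5 * d) * INR k5 ^ 2))
       - 4 * (- / (INR d * INR k1 ^ 2)) - 2 * (- / (INR (10 * d) * INR k10 ^ 2))).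
  - apply is_lim_seq_minus'; [apply is_lim_seq_minus'; [apply is_lim_seq_plus'|]|];
      apply (is_lim_seq_scal_l _ _ (Finite _)); trivial.
  - assert (Hd' : 0 < INR d) by now apply lt_0_INR.
    assert (K1 : 0 < INR k1) by apply lt_0_INR, F1.
    assert (K2 : 0 < INR k2) by apply lt_0_INR, F2.
    assert (K5 : 0 < INR k5) by apply lt_0_INR, F5.
    assert (K10 : 0 < INR k10) by apply lt_0_INR, F10.
    apply Rmult_eq_reg_l with (INR d); [|lra].
    rewrite Hl, !mult_INR; simpl INR; field; lra.
Qed.

Lemma gcd_mul_1 (k a b : nat) :
  Nat.gcd k a = 1%nat -> Nat.gcd k b = 1%nat -> Nat.gcd k (a * b) = 1%nat.
Proof.
  intros Ha Hb; set (g := Nat.gcd k (a * b)).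
  assert (G1 : Nat.divide g k) by apply Nat.gcd_divide_l.
  assert (G2 : Nat.divide g (a * b)) by apply Nat.gcd_divide_r.
  assert (G3 : Nat.gcd g a = 1%nat).
  { apply Nat.divide_1_r; rewrite <- Ha; apply Nat.gcd_greatest.
    - apply Nat.divide_trans with (2 := G1), Nat.gcd_divide_l.
    - apply Nat.gcd_divide_r. }
  apply Nat.gauss in G2; trivial.
  apply Nat.divide_1_r; rewrite <- Hb; now apply Nat.gcd_greatest.
Qed.

(** All four points keep the denominator [k], and [4 - 1 - 4/5 + 1/5 = 12/5]. *)
Lemma gfun_rate_pole (h k d : nat) :
  (0 < k)%nat -> (0 < d)%nat ->
  Nat.gcd k h = 1%nat -> Nat.gcd k 2 = 1%nat -> Nat.gcd k 5 = 1%nat ->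
  (forall n, 0 < Cmod (gfun (INR h / INR k, INR d * s_seq n / (2 * PI)))) /\
  is_lim_seq (fun n => ln (Cmod (gfun (INR h / INR k, INR d * s_seq n / (2 * PI)))) / scale n)
    (12 / 5 / (INR k ^ 2 * INR d)).
Proof.
  intros Hk Hd Hh H2 H5.
  assert (0 < INR k) by now apply lt_0_INR.
  assert (0 < INR d) by now apply lt_0_INR.
  apply (gfun_rate _ _ d h k (2 * h) k (5 * h) k (10 * h) k Hd).
  - repeat split; trivial.
  - repeat split; trivial; [now apply gcd_mul_1 | rewrite mult_INR; simpl INR; field; lra].
  - repeat split; trivial; [now apply gcd_mul_1 | rewrite mult_INR; simpl INR; field; lra].
  - repeat split; trivial.
    + apply gcd_mul_1; trivial; change 10%nat with (2 * 5)%nat; now apply gcd_mul_1.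
    + rewrite mult_INR; simpl INR; field; lra.
  - field; lra.
Qed.

(** The denominator is [5 m] at [x] and [2 x] but drops to [m] at [5 x] and [10 x]; the rate is
    [(4 - 1)/25 - 4/5 + 1/5 = -12/25]. *)
Lemma gfun_rate_zero (h m d : nat) :
  (0 < m)%nat -> (0 < d)%nat ->
  Nat.gcd (5 * m) h = 1%nat -> Nat.gcd m 2 = 1%nat ->
  (forall n, 0 < Cmod (gfun (INR h / INR (5 * m), INR d * s_seq n / (2 * PI)))) /\
  is_lim_seq (fun n => ln (Cmod (gfun (INR h / INR (5 * m), INR d * s_seq n / (2 * PI)))) / scale n)
    (- (12 / 25) / (INR m ^ 2 * INR d)).
Proof.
  intros Hm Hd Hh H2.
  assert (0 < INR m) by now apply lt_0_INR.
  assert (0 < INR d) by now apply lt_0_INR.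
  assert (H10 : Nat.gcd (5 * m) 2 = 1%nat).
  { rewrite Nat.gcd_comm; apply gcd_mul_1; trivial; now rewrite Nat.gcd_comm. }
  assert (Hmh : Nat.gcd m h = 1%nat).
  { apply Nat.divide_1_r; rewrite <- Hh; apply Nat.gcd_greatest; [|apply Nat.gcd_divide_r].
    apply Nat.divide_mul_r, Nat.gcd_divide_l. }
  apply (gfun_rate _ _ d h (5 * m) (2 * h) (5 * m) h m (2 * h) m Hd).
  - repeat split; trivial; lia.
  - repeat split; [lia | now apply gcd_mul_1 | rewrite !mult_INR; simpl INR; field; lra].
  - repeat split; trivial; rewrite !mult_INR; simpl INR; field; lra.
  - repeat split; trivial; [now apply gcd_mul_1 | rewrite !mult_INR; simpl INR; field; lra].
  - rewrite mult_INR; simpl INR; field; lra.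
Qed.

(** * Isolating the dominant term of a polynomial relation *)

Lemma is_lim_seq_sum_n (u : nat -> nat -> R) (l : nat -> R) (d : nat) :
  (forall i, (i <= d)%nat -> is_lim_seq (fun n => u n i) (l i)) ->
  is_lim_seq (fun n => sum_n (u n) d) (sum_n l d).
Proof.
  induction d as [|d IH]; intros H.
  - apply is_lim_seq_ext with (fun n => u n 0%nat); [intros; now rewrite sum_O|].
    rewrite sum_O; now apply H.
  - apply is_lim_seq_ext with (fun n => sum_n (u n) d + u n (S d)).
    + intros; now rewrite sum_Sn.
    + rewrite sum_Sn; apply is_lim_seq_plus'; [apply IH; intros; apply H; lia | apply H; lia].
Qed.

Lemma sum_n_single (l : nat -> R) (d i0 : nat) :
  (i0 <= d)%nat -> (forall i, (i <= d)%nat -> i <> i0 -> l i = 0) -> sum_n l d = l i0.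
Proof.
  revert i0; induction d as [|d IH]; intros i0 H0 H.
  - rewrite sum_O; f_equal; lia.
  - rewrite sum_Sn; change (sum_n l d + l (S d) = l i0).
    destruct (Nat.eq_dec i0 (S d)) as [->|E].
    + replace (sum_n l d) with 0; [ring|].
      rewrite (sum_n_ext_loc l (fun _ => 0)); [|intros; apply H; lia].
      rewrite sum_n_const; ring.
    + rewrite (IH i0), (H (S d)) by (try intros; try apply H; lia); ring.
Qed.

Lemma Re_mult_sum_n (a : nat -> C) (w : C) (d : nat) :
  Re (sum_n a d * w)%C = sum_n (fun i => Re (a i * w)%C) d.
Proof.
  induction d as [|d IH]; [now rewrite !sum_O|].
  rewrite !sum_Sn, <- IH.
  change (Re ((sum_n a d + a (S d)) * w)%C = Re (sum_n a d * w)%C + Re (a (S d) * w)%C).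
  unfold Re, Cmult, Cplus; cbn [fst snd]; ring.
Qed.

Lemma ln_div_scale_lim_m (t : nat -> R) (l : R) :
  l < 0 -> (forall n, 0 < t n) -> is_lim_seq (fun n => ln (t n) / scale n) l ->
  is_lim_seq t 0.
Proof.
  intros Hl Ht H.
  assert (Hm : is_lim_seq (fun n => ln (t n)) m_infty).
  { apply is_lim_seq_ext with (fun n => ln (t n) / scale n * scale n).
    { intros n; field; apply Rgt_not_eq, scale_pos. }
    apply (is_lim_seq_mult _ _ l p_infty); [trivial | apply scale_lim|].
    apply is_Rbar_mult_sym, is_Rbar_mult_p_infty_neg; exact Hl. }
  apply is_lim_seq_ext with (fun n => exp (ln (t n))); [intros; now apply exp_ln|].
  apply (is_lim_comp_seq exp _ m_infty 0 is_lim_exp_m); trivial.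
  exists 0%nat; intros; discriminate.
Qed.

(** Divide the relation by the monomial at [(i0, j0)]. Every other nonzero term then has a logarithm
    asymptotic to a negative multiple of [scale] and tends to 0, so the limit of the zero sum is
    [c i0 j0]. Real parts lose nothing, since this coefficient is real. *)
Lemma dominant_term_vanishes (d : nat) (c : nat -> nat -> R) (x y : nat -> C) (al be : R)
    (i0 j0 : nat) :
  (forall n, 0 < Cmod (x n)) -> (forall n, 0 < Cmod (y n)) ->
  is_lim_seq (fun n => ln (Cmod (x n)) / scale n) al ->
  is_lim_seq (fun n => ln (Cmod (y n)) / scale n) be ->
  (forall n, sum_n (fun i => sum_n (fun j => RtoC (c i j) * (cpow (x n) i * cpow (y n) j))%C d) d
             = RtoC 0) ->
  (i0 <= d)%nat -> (j0 <= d)%nat ->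
  (forall i j, (i <= d)%nat -> (j <= d)%nat -> (i, j) <> (i0, j0) ->
     c i j = 0 \/ INR i * al + INR j * be < INR i0 * al + INR j0 * be) ->
  c i0 j0 = 0.
Proof.
  intros Px Py Lx Ly Hsum Hi0 Hj0 Hdom.
  set (w := fun n => (/ (cpow (x n) i0 * cpow (y n) j0))%C).
  set (T := fun n i j => Re (RtoC (c i j) * (cpow (x n) i * cpow (y n) j) * w n)%C).
  set (l := fun i j => if Nat.eq_dec i i0 then if Nat.eq_dec j j0 then c i0 j0 else 0 else 0).
  assert (Nz : forall n i j, (cpow (x n) i * cpow (y n) j)%C <> RtoC 0).
  { intros n i j; apply Cmod_gt_0; rewrite Cmod_mult, !cpow_Cpow, !Cmod_pow.
    apply Rmult_lt_0_compat; now apply pow_lt. }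
  assert (HT : forall i j, (i <= d)%nat -> (j <= d)%nat -> is_lim_seq (fun n => T n i j) (l i j)).
  { intros i j Hi Hj.
    assert (Hc : (i, j) = (i0, j0) \/ ((i, j) <> (i0, j0) /\ l i j = 0)).
    { unfold l; destruct (Nat.eq_dec i i0) as [->|Ei]; [destruct (Nat.eq_dec j j0) as [->|Ej]|];
        [left; trivial | right; split; congruence | right; split; congruence]. }
    destruct Hc as [Hc|[Hc ->]].
    - injection Hc as -> ->.
      replace (l i0 j0) with (c i0 j0).
      2:{ unfold l; destruct (Nat.eq_dec i0 i0), (Nat.eq_dec j0 j0); congruence. }
      apply is_lim_seq_ext with (fun _ => c i0 j0); [|apply is_lim_seq_const].
      intros n; unfold T, w.
      rewrite <- Cmult_assoc, Cinv_r, Cmult_1_r by apply Nz; trivial.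
    - destruct (Hdom i j Hi Hj Hc) as [E|E].
      + apply is_lim_seq_ext with (fun _ => 0); [|apply is_lim_seq_const].
        intros n; unfold T; rewrite E.
        replace (RtoC 0 * (cpow (x n) i * cpow (y n) j) * w n)%C with (RtoC 0) by ring; trivial.
      + apply is_lim_seq_abs_0.
        assert (Hz : is_lim_seq (fun n => Rabs (c i j) *
             (Cmod (x n) ^ i * Cmod (y n) ^ j / (Cmod (x n) ^ i0 * Cmod (y n) ^ j0))) 0).
        { replace (Finite 0) with (Rbar_mult (Rabs (c i j)) 0) by (simpl; f_equal; ring).
          apply is_lim_seq_scal_l.
          apply ln_div_scale_lim_m with
            ((INR i * al + INR j * be) - (INR i0 * al + INR j0 * be)); [lra | |].
          - intros n; apply Rdiv_lt_0_compat; apply Rmult_lt_0_compat; now apply pow_lt.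
          - apply is_lim_seq_ext with (fun n =>
              (INR i * (ln (Cmod (x n)) / scale n) + INR j * (ln (Cmod (y n)) / scale n))
              - (INR i0 * (ln (Cmod (x n)) / scale n) + INR j0 * (ln (Cmod (y n)) / scale n))).
            + intros n.
              assert (Q := fun m => pow_lt _ m (Px n)); assert (Q' := fun m => pow_lt _ m (Py n)).
              rewrite ln_div by now apply Rmult_lt_0_compat.
              rewrite !ln_mult, !ln_pow by trivial.
              field; apply Rgt_not_eq, scale_pos.
            + apply is_lim_seq_minus'; apply is_lim_seq_plus';
                now apply (is_lim_seq_scal_l _ _ (Finite _)). }
        apply is_lim_seq_le_le with (2 := is_lim_seq_const 0) (3 := Hz).
        intros n; split; [apply Rabs_pos|].
        eapply Rle_trans; [apply re_le_Cmod|].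
        unfold w; rewrite !Cmod_mult, Cmod_inv, Cmod_R by apply Nz.
        rewrite !Cmod_mult, !cpow_Cpow, !Cmod_pow; right; unfold Rdiv; ring. }
  assert (H0 : is_lim_seq (fun n => sum_n (fun i => sum_n (fun j => T n i j) d) d)
                 (sum_n (fun i => sum_n (fun j => l i j) d) d)).
  { apply (is_lim_seq_sum_n (fun n i => sum_n (fun j => T n i j) d)
             (fun i => sum_n (fun j => l i j) d)); intros i Hi.
    apply (is_lim_seq_sum_n (fun n j => T n i j) (fun j => l i j)); auto. }
  assert (H1 : sum_n (fun i => sum_n (fun j => l i j) d) d = c i0 j0).
  { rewrite (sum_n_single _ d i0), (sum_n_single _ d j0); trivial.
    - unfold l; destruct (Nat.eq_dec i0 i0), (Nat.eq_dec j0 j0); congruence.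
    - intros j Hj E; unfold l; destruct (Nat.eq_dec i0 i0), (Nat.eq_dec j j0); congruence.
    - intros i Hi E; rewrite (sum_n_single _ d j0); trivial.
      + unfold l; destruct (Nat.eq_dec i i0); congruence.
      + intros j Hj E'; unfold l; destruct (Nat.eq_dec i i0); congruence. }
  rewrite H1 in H0.
  apply (is_lim_seq_ext _ (fun _ => 0)) in H0.
  - apply is_lim_seq_unique in H0; rewrite Lim_seq_const in H0; congruence.
  - intros n; unfold T.
    transitivity (Re (RtoC 0 * w n)%C); [|simpl; ring].
    rewrite <- (Hsum n), Re_mult_sum_n.
    apply sum_n_ext; intros i; symmetry; apply Re_mult_sum_n.
Qed.

(** * Combinatorics of the Newton polygon *)

(* [V i j] stands for the vanishing of the coefficient of [X^i Y^j]: whenever all other terms are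
   absent or of smaller weight [a i + b j], the term is absent too. *)
Definition weight_rule (d : nat) (V : nat -> nat -> Prop) (a b : Z) : Prop :=
  forall i0 j0, (i0 <= d)%nat -> (j0 <= d)%nat ->
    (forall i j, (i <= d)%nat -> (j <= d)%nat -> (i, j) <> (i0, j0) ->
       V i j \/ (a * Z.of_nat i + b * Z.of_nat j < a * Z.of_nat i0 + b * Z.of_nat j0)%Z) ->
    V i0 j0.

Lemma weight_rule_transpose (d : nat) (V : nat -> nat -> Prop) (a b : Z) :
  weight_rule d V a b -> weight_rule d (fun i j => V j i) b a.
Proof.
  intros H i0 j0 Hi0 Hj0 Hd; apply (H j0 i0); trivial.
  intros i j Hi Hj E; destruct (Hd j i) as [G|G]; trivial; [congruence | now left | right; lia].
Qed.

(** Terms with [i <= p] have weight at most [p^2 + p + 1], strictly below [p (p + 1) + j] once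
    [j >= 2]. The only rivals lie further along the same row, so [j] descends from [p + 1]. *)
Lemma top_row_tail (p : nat) (V : nat -> nat -> Prop) :
  (2 <= p)%nat -> weight_rule (p + 1) V (Z.of_nat p) 1 ->
  forall j, (2 <= j <= p + 1)%nat -> V (p + 1)%nat j.
Proof.
  intros Hp H.
  assert (G : forall m j, (p + 1 - j = m)%nat -> (2 <= j <= p + 1)%nat -> V (p + 1)%nat j).
  { induction m as [m IH] using lt_wf_ind; intros j0 Hm Hj0.
    apply H; [lia | lia|]; intros i j Hi Hj E.
    destruct (Nat.eq_dec i (p + 1)) as [->|Ei].
    - destruct (Nat.lt_ge_cases j0 j) as [Hlt|Hge].
      + left; apply (IH (p + 1 - j)%nat); lia.
      + right; assert (j <> j0) by congruence; lia.
    - right; assert (i <= p)%nat by lia; nia. }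
  intros j; now apply (G (p + 1 - j)%nat).
Qed.

(** At [j = 1] there is exactly one tie outside the row, [(p, p + 1)], and the transposed tail
    already makes it vanish. *)
Lemma top_row (p : nat) (V : nat -> nat -> Prop) :
  (2 <= p)%nat -> weight_rule (p + 1) V (Z.of_nat p) 1 -> weight_rule (p + 1) V 1 (Z.of_nat p) ->
  forall j, (1 <= j <= p + 1)%nat -> V (p + 1)%nat j.
Proof.
  intros Hp H H' j0 Hj0.
  assert (T := top_row_tail p V Hp H).
  assert (T' := top_row_tail p _ Hp (weight_rule_transpose _ _ _ _ H')); cbn beta in T'.
  destruct (Nat.eq_dec j0 1) as [->|E1]; [|apply T; lia].
  apply H; [lia | lia|]; intros i j Hi Hj E.
  destruct (Nat.eq_dec i (p + 1)) as [->|Ei].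
  - destruct (Nat.eq_dec j 0) as [->|Ej]; [right; lia | left; apply T].
    assert (j <> 1%nat) by congruence; lia.
  - destruct (Nat.eq_dec i p) as [->|Ei'].
    + destruct (Nat.eq_dec j (p + 1)) as [->|Ej]; [left; apply T'; lia | right; nia].
    + right; assert (i <= p - 1)%nat by lia; nia.
Qed.

(** A term with [i >= 1] has [p i + j >= p], so for [j < p] the only rivals precede it in row 0, and
    [j] ascends from 0. *)
Lemma bottom_row_head (p : nat) (V : nat -> nat -> Prop) :
  weight_rule (p + 1) V (- Z.of_nat p) (-1) -> forall j, (j < p)%nat -> V 0%nat j.
Proof.
  intros H; induction j as [j0 IH] using lt_wf_ind; intros Hj0.
  apply H; [lia | lia|]; intros i j Hi Hj E.
  destruct i as [|i]; [|right; nia].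
  destruct (Nat.lt_ge_cases j j0) as [Hlt|Hge].
  - left; apply IH; lia.
  - right; assert (j <> j0) by congruence; lia.
Qed.

(** At [j = p] the only new tie is [(1, 0)], which vanishes by the transposed head because
    [1 < p]. *)
Lemma bottom_row (p : nat) (V : nat -> nat -> Prop) :
  (2 <= p)%nat -> weight_rule (p + 1) V (- Z.of_nat p) (-1) ->
  weight_rule (p + 1) V (-1) (- Z.of_nat p) ->
  forall j, (j <= p)%nat -> V 0%nat j.
Proof.
  intros Hp H H' j0 Hj0.
  assert (T := bottom_row_head p V H).
  assert (T' := bottom_row_head p _ (weight_rule_transpose _ _ _ _ H')); cbn beta in T'.
  destruct (Nat.eq_dec j0 p) as [->|Ej0]; [|apply T; lia].
  apply H; [lia | lia|]; intros i j Hi Hj E.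
  destruct i as [|i].
  - destruct (Nat.lt_ge_cases j p) as [Hlt|Hge]; [left; now apply T | right].
    assert (j <> p) by congruence; lia.
  - destruct (Nat.eq_dec i 0) as [->|Ei].
    + destruct (Nat.eq_dec j 0) as [->|Ej]; [left; apply T'; lia | right; nia].
    + right; nia.
Qed.

(** The contrapositive of claim (1): once this corner is gone, the border retains at most
    [(0, p + 1)], and the interior can be peeled off term by term until that corner stands alone. *)
Lemma corner_forces_zero (p : nat) (V : nat -> nat -> Prop) :
  (2 <= p)%nat ->
  weight_rule (p + 1) V (Z.of_nat p) 1 -> weight_rule (p + 1) V 1 (Z.of_nat p) ->
  weight_rule (p + 1) V (- Z.of_nat p) (-1) -> weight_rule (p + 1) V (-1) (- Z.of_nat p) ->
  V (p + 1)%nat 0%nat ->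
  forall i j, (i <= p + 1)%nat -> (j <= p + 1)%nat -> V i j.
Proof.
  intros Hp R1 R2 R3 R4 H0.
  assert (Top := top_row p V Hp R1 R2).
  assert (Top' := top_row p _ Hp (weight_rule_transpose _ _ _ _ R2)
                    (weight_rule_transpose _ _ _ _ R1)); cbn beta in Top'.
  assert (Bot := bottom_row p V Hp R3 R4).
  assert (Bot' := bottom_row p _ Hp (weight_rule_transpose _ _ _ _ R4)
                    (weight_rule_transpose _ _ _ _ R3)); cbn beta in Bot'.
  assert (Row0 : forall i, (i <= p + 1)%nat -> V i 0%nat).
  { intros i Hi; destruct (Nat.eq_dec i (p + 1)) as [->|]; [trivial | apply Bot'; lia]. }
  (* Interior terms are removed in increasing order of [i + p j], whose value determines [(i, j)]
     when [1 <= i <= p]. The point [(p, p)] is left out because it ties with [(0, p + 1)] at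
     [p^2 + p]. *)
  assert (Mid : forall w i j, (i + p * j = w)%nat -> (1 <= i <= p)%nat -> (1 <= j <= p)%nat ->
                  (i, j) <> (p, p) -> V i j).
  { induction w as [w IH] using lt_wf_ind; intros i0 j0 Hw Hi0 Hj0 E0.
    apply R4; [lia | lia|]; intros i j Hi Hj E.
    destruct (Nat.eq_dec j 0) as [->|Ej]; [left; now apply Row0|].
    destruct (Nat.eq_dec i (p + 1)) as [->|Ei]; [left; apply Top; lia|].
    assert (B : (i0 + p * j0 < p + p * p)%nat).
    { destruct (Nat.eq_dec i0 p) as [->|]; [|nia].
      assert (j0 <> p) by congruence; nia. }
    destruct (Nat.eq_dec i 0) as [->|Ei0].
    { destruct (Nat.eq_dec j (p + 1)) as [->|]; [right; nia | left; apply Bot; lia]. }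
    destruct (Nat.eq_dec j (p + 1)) as [->|Ej']; [left; apply Top'; lia|].
    destruct (Nat.lt_trichotomy (i + p * j) (i0 + p * j0)) as [L|[L|L]].
    - left; apply (IH (i + p * j)%nat); try lia.
      intros X; injection X as -> ->; lia.
    - exfalso; apply E; assert (j = j0) by nia; subst j; f_equal; lia.
    - right; lia. }
  assert (Mid' : forall i j, (1 <= i <= p)%nat -> (1 <= j <= p)%nat -> V i j).
  { intros i0 j0 Hi0 Hj0.
    destruct (Nat.eq_dec i0 p) as [->|]; [|apply (Mid _ _ _ eq_refl); trivial; congruence].
    destruct (Nat.eq_dec j0 p) as [->|]; [|apply (Mid _ _ _ eq_refl); trivial; congruence].
    (* The weight [p i + j] breaks that tie: it is [p^2 + p] at [(p, p)] but only [p + 1] at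
       [(0, p + 1)]. *)
    apply R1; [lia | lia|]; intros i j Hi Hj E.
    destruct (Nat.eq_dec j 0) as [->|Ej]; [left; now apply Row0|].
    destruct (Nat.eq_dec i (p + 1)) as [->|Ei]; [left; apply Top; lia|].
    destruct (Nat.eq_dec i 0) as [->|Ei0]; [right; nia|].
    destruct (Nat.eq_dec j (p + 1)) as [->|Ej']; [left; apply Top'; lia|].
    left; apply (Mid _ _ _ eq_refl); trivial; lia. }
  assert (Rest : forall i j, (i <= p + 1)%nat -> (j <= p + 1)%nat ->
                   (i, j) <> (0, p + 1)%nat -> V i j).
  { intros i j Hi Hj E.
    destruct (Nat.eq_dec j 0) as [->|Ej]; [now apply Row0|].
    destruct (Nat.eq_dec i (p + 1)) as [->|Ei]; [apply Top; lia|].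
    destruct (Nat.eq_dec i 0) as [->|Ei0].
    { apply Bot; assert (j <> p + 1)%nat by congruence; lia. }
    destruct (Nat.eq_dec j (p + 1)) as [->|Ej']; [apply Top'; lia|].
    apply Mid'; lia. }
  intros i0 j0 Hi0 Hj0.
  destruct (Nat.eq_dec i0 0) as [->|]; [|apply Rest; trivial; congruence].
  destruct (Nat.eq_dec j0 (p + 1)) as [->|]; [|apply Rest; trivial; congruence].
  apply R1; trivial; intros i j Hi Hj E; left; now apply Rest.
Qed.

(** * From rates at the cusps to the coefficients of the modular equation *)

Lemma modular_equation_weight_rule (p : nat) (Cf : nat -> nat -> Q)
    (x kap : R) (al be : Z) :
  0 < kap -> (0 < p)%nat ->
  (forall tau : C, 0 < Im tau ->
     poly2_eval (p + 1) Cf (gfun tau) (gfun (Cmult (RtoC (INR p)) tau)) = RtoC 0) ->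
  (forall n, 0 < Cmod (gfun (x, INR 1 * s_seq n / (2 * PI)))) /\
  is_lim_seq (fun n => ln (Cmod (gfun (x, INR 1 * s_seq n / (2 * PI)))) / scale n)
    (kap * IZR al) ->
  (forall n, 0 < Cmod (gfun (INR p * x, INR p * s_seq n / (2 * PI)))) /\
  is_lim_seq (fun n => ln (Cmod (gfun (INR p * x, INR p * s_seq n / (2 * PI)))) / scale n)
    (kap * IZR be) ->
  weight_rule (p + 1) (fun i j => (Cf i j == 0)%Q) al be.
Proof.
  intros Hkap Hp Heq [Px Lx] [Py Ly] i0 j0 Hi0 Hj0 Hdom.
  apply Qreals.eqR_Qeq; rewrite RMicromega.Q2R_0.
  apply (dominant_term_vanishes (p + 1) (fun i j => Q2R (Cf i j)) _ _ _ _ i0 j0 Px Py Lx Ly);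
    trivial.
  - intros n.
    assert (Hs := s_seq_pos n); assert (HPI := PI_RGT_0).
    assert (E : (RtoC (INR p) * (x, (INR 1 * s_seq n / (2 * PI))%R))%C
                = (INR p * x, INR p * s_seq n / (2 * PI))).
    { apply injective_projections; simpl; field; lra. }
    rewrite <- (Heq (x, INR 1 * s_seq n / (2 * PI))), E; trivial.
    simpl; apply Rdiv_lt_0_compat; lra.
  - intros i j Hi Hj E; destruct (Hdom i j Hi Hj E) as [G|G].
    + left; rewrite <- RMicromega.Q2R_0; now apply Qreals.Qeq_eqR.
    (* Multiplying by the positive factor [kap] turns the integer weight inequality into one between
       the actual rates. *)
    + right; apply IZR_lt in G.
      rewrite !plus_IZR, !mult_IZR, <- !INR_IZR_INZ in G; nra.
Qed.

Lemma prime_coprime (p a : nat) :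
  prime (Z.of_nat p) -> prime (Z.of_nat a) -> p <> a -> Nat.gcd p a = 1%nat.
Proof.
  intros Hp Ha Hne.
  destruct (Nat.gcd_divide p a) as [[u Hu] [v Hv]]; set (g := Nat.gcd p a) in *.
  assert (Dp : (Z.of_nat g | Z.of_nat p)) by (exists (Z.of_nat u); lia).
  assert (Da : (Z.of_nat g | Z.of_nat a)) by (exists (Z.of_nat v); lia).
  assert (Hp2 := prime_ge_2 _ Hp); assert (Ha2 := prime_ge_2 _ Ha).
  apply prime_divisors in Dp, Da; trivial; lia.
Qed.

Lemma prime_5 : prime 5.
Proof.
  apply prime_intro; [lia|]; intros n Hn.
  assert (H : (n = 1 \/ n = 2 \/ n = 3 \/ n = 4)%Z) by lia.
  destruct H as [->|[->|[->| ->]]]; now apply Zgcd_1_rel_prime.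
Qed.

Theorem theorem4p7 (p : nat) (Cf : nat -> nat -> Q) :
  prime (Z.of_nat p) -> p <> 2%nat -> p <> 5%nat ->
  (exists i j, (i <= p + 1)%nat /\ (j <= p + 1)%nat /\ ~ (Cf i j == 0)%Q) ->
  (forall tau : C, 0 < Im tau ->
     poly2_eval (p + 1) Cf (gfun tau) (gfun (Cmult (RtoC (INR p)) tau)) = RtoC 0) ->
  (~ (Cf (p + 1)%nat 0%nat == 0)%Q /\ ~ (Cf 0%nat (p + 1)%nat == 0)%Q) /\
  (forall j, (1 <= j <= p + 1)%nat -> (Cf (p + 1)%nat j == 0)%Q /\ (Cf j (p + 1)%nat == 0)%Q) /\
  (forall j, (j <= p)%nat -> (Cf 0%nat j == 0)%Q /\ (Cf j 0%nat == 0)%Q).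
Proof.
  intros Hprime H2 H5 (i0 & j0 & Hi0 & Hj0 & Hne) Heq.
  assert (Hp2 : (2 <= p)%nat) by (generalize (prime_ge_2 _ Hprime); lia).
  assert (G2 : Nat.gcd p 2 = 1%nat) by (apply prime_coprime; trivial; apply prime_2).
  assert (G5 : Nat.gcd p 5 = 1%nat) by (apply prime_coprime; trivial; apply prime_5).
  assert (G5' : Nat.gcd 5 p = 1%nat) by now rewrite Nat.gcd_comm.
  assert (Hp : (0 < p)%nat) by lia.
  assert (HpR : 0 < INR p) by now apply lt_0_INR.
  (* The four weights come from approaching the cusps 0, 1/p, 1/5 and 1/(5p). *)
  assert (R1 : weight_rule (p + 1) (fun i j => (Cf i j == 0)%Q) (Z.of_nat p) 1).
  (* The rates are [12/5] at [tau] and [12/(5 p)] at [p tau], the latter being [p] times as high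
     above 0. *)
  { apply modular_equation_weight_rule with (INR 0 / INR 1) (12 / 5 / INR p); trivial.
    - apply Rdiv_lt_0_compat; lra.
    - replace (12 / 5 / INR p * IZR (Z.of_nat p)) with (12 / 5 / (INR 1 ^ 2 * INR 1))
        by (rewrite <- INR_IZR_INZ; simpl; field; lra).
      apply gfun_rate_pole; trivial; lia.
    - replace (INR p * (INR 0 / INR 1)) with (INR 0 / INR 1) by (simpl; field).
      replace (12 / 5 / INR p * 1) with (12 / 5 / (INR 1 ^ 2 * INR p)) by (simpl; field; lra).
      apply gfun_rate_pole; trivial; lia. }
  assert (R2 : weight_rule (p + 1) (fun i j => (Cf i j == 0)%Q) 1 (Z.of_nat p)).
  (* The rate at [tau] is [12/(5 p^2)]; multiplication by [p] moves the cusp to the integer 1, where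
     the rate is [12/(5 p)]. *)
  { apply modular_equation_weight_rule with (INR 1 / INR p) (12 / 5 / INR p ^ 2); trivial.
    - apply Rdiv_lt_0_compat; [lra | now apply pow_lt].
    - replace (12 / 5 / INR p ^ 2 * 1) with (12 / 5 / (INR p ^ 2 * INR 1)) by (simpl; field; lra).
      apply gfun_rate_pole; trivial; [lia | rewrite Nat.gcd_comm; reflexivity].
    - replace (INR p * (INR 1 / INR p)) with (INR 1 / INR 1) by (simpl; field; lra).
      replace (12 / 5 / INR p ^ 2 * IZR (Z.of_nat p)) with (12 / 5 / (INR 1 ^ 2 * INR p))
        by (rewrite <- INR_IZR_INZ; simpl; field; lra).
      apply gfun_rate_pole; trivial; lia. }
  assert (R3 : weight_rule (p + 1) (fun i j => (Cf i j == 0)%Q) (- Z.of_nat p) (-1)).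
  { apply modular_equation_weight_rule with (INR 1 / INR (5 * 1)) (12 / 25 / INR p); trivial.
    - apply Rdiv_lt_0_compat; lra.
    - replace (12 / 25 / INR p * IZR (- Z.of_nat p)) with (- (12 / 25) / (INR 1 ^ 2 * INR 1))
        by (rewrite opp_IZR, <- INR_IZR_INZ; simpl; field; lra).
      apply gfun_rate_zero; trivial; lia.
    - replace (INR p * (INR 1 / INR (5 * 1))) with (INR p / INR (5 * 1)) by (simpl; field).
      replace (12 / 25 / INR p * -1) with (- (12 / 25) / (INR 1 ^ 2 * INR p))
        by (simpl; field; lra).
      apply gfun_rate_zero; trivial; lia. }
  assert (R4 : weight_rule (p + 1) (fun i j => (Cf i j == 0)%Q) (-1) (- Z.of_nat p)).
  (* Here [p tau] tends to 1/5, so the rates are [-12/(25 p^2)] and [-12/(25 p)]. *)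
  { apply modular_equation_weight_rule with (INR 1 / INR (5 * p)) (12 / 25 / INR p ^ 2); trivial.
    - apply Rdiv_lt_0_compat; [lra | now apply pow_lt].
    - replace (12 / 25 / INR p ^ 2 * -1) with (- (12 / 25) / (INR p ^ 2 * INR 1))
        by (simpl; field; lra).
      apply gfun_rate_zero; trivial; [lia | rewrite Nat.gcd_comm; reflexivity].
    - replace (INR p * (INR 1 / INR (5 * p))) with (INR 1 / INR (5 * 1))
        by (rewrite !mult_INR; simpl; field; lra).
      replace (12 / 25 / INR p ^ 2 * IZR (- Z.of_nat p)) with (- (12 / 25) / (INR 1 ^ 2 * INR p))
        by (rewrite opp_IZR, <- INR_IZR_INZ; simpl; field; lra).
      apply gfun_rate_zero; trivial; lia. }
  (* Exchanging [X] and [Y] swaps the two weights of each sign, so every claim on rows also gives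
     the claim on columns. *)
  assert (T1 := weight_rule_transpose _ _ _ _ R1).
  assert (T2 := weight_rule_transpose _ _ _ _ R2).
  assert (T3 := weight_rule_transpose _ _ _ _ R3).
  assert (T4 := weight_rule_transpose _ _ _ _ R4).
  repeat split.
  - intros E; apply Hne.
    apply (corner_forces_zero p (fun i j => (Cf i j == 0)%Q) Hp2 R1 R2 R3 R4 E i0 j0 Hi0 Hj0).
  - intros E; apply Hne.
    apply (corner_forces_zero p (fun i j => (Cf j i == 0)%Q) Hp2 T2 T1 T4 T3 E j0 i0 Hj0 Hi0).
  - now apply (top_row p (fun i j => (Cf i j == 0)%Q) Hp2 R1 R2).
  - now apply (top_row p (fun i j => (Cf j i == 0)%Q) Hp2 T2 T1).
  - now apply (bottom_row p (fun i j => (Cf i j == 0)%Q) Hp2 R3 R4).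
  - now apply (bottom_row p (fun i j => (Cf j i == 0)%Q) Hp2 T4 T3).
Qed.
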